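(* For any $x,w\in\mathbf{I}_*$ such that $x\le w$ we have $P^\sigma_{x,w}\equiv P_{x,w}$, that is, $P^\sigma_{x,w}$ and $P_{x,w}$ have the same image in $(\mathbf{Z}/2)[v,v^{-1}]$ (equivalently, $P^\sigma_{x,w}-P_{x,w}\in 2\mathbf{Z}[u]$).
   Context: $W$ is a Coxeter group with set of simple reflections $S$, length function $l:W\to\mathbf{N}$ and Bruhat order $\le$. $w\mapsto w^*$ is an automorphism of $W$ with square $1$ which leaves $S$ stable. $\mathbf{I}_*=\{w\in W : (w^* )^{-1}=w\}$. $u$ is an indeterminate and $\mathcal{A}=\mathbf{Z}[u,u^{-1}]$. $\mathfrak{H}$ is the free $\mathcal{A}$-module with basis $(T_w)_{w\in W}$ with the unique $\mathcal{A}$-algebra structure with unit $T_1$ such that $T_wT_{w'}=T_{ww'}$ if $l(ww')=l(w)+l(w')$, and $(T_s+1)(T_s-u^2)=0$ for all $s\in S$. $\overline{\phantom{x}}:\mathfrak{H}\to\mathfrak{H}$ is the unique ring involution such that $\overline{u^nT_x}=u^{-n}T_{x^{-1}}^{-1}$ for $x\in W$, $n\in\mathbf{Z}$. $M$ is the free $\mathcal{A}$-module with basis $\{a_w : w\in\mathbf{I}_*\}$, with its unique $\mathfrak{H}$-module structure such that for $s\in S$, $w\in\mathbf{I}_*$: $T_s a_w = u a_w + (u+1)a_{sw}$ if $sw = ws^* > w$; $T_s a_w = (u^2-u-1)a_w + (u^2-u)a_{sw}$ if $sw = ws^* < w$; $T_s a_w = a_{sws^*}$ if $sw\ne ws^*$,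 $sw > w$; $T_s a_w = (u^2-1)a_w + u^2 a_{sws^*}$ if $sw\ne ws^*$, $sw < w$. $\overline{\phantom{x}}:M\to M$ is the unique $\mathbf{Z}$-linear map such that $\overline{hm}=\overline{h}\,\overline{m}$ for $h\in\mathfrak{H}$, $m\in M$ and $\overline{a_1}=a_1$. $v$ is an indeterminate, $\underline{\mathcal{A}}=\mathbf{Z}[v,v^{-1}]\supset\mathcal{A}$ via $u=v^2$. $\underline{M}=\underline{\mathcal{A}}\otimes_{\mathcal{A}}M$, and $\overline{\phantom{x}}$ is extended to $\underline{M}$ by $\overline{v^nm}=v^{-n}\overline{m}$ for $m\in M$, $n\in\mathbf{Z}$. For $w\in\mathbf{I}_*$, $A_w=v^{-l(w)}\sum_{y\in\mathbf{I}_*;\,y\le w}P^\sigma_{y,w}a_y\in\underline{M}$ (with $P^\sigma_{y,w}\in\mathbf{Z}[u]$) is the unique element of this form such that $\overline{A_w}=A_w$, $P^\sigma_{w,w}=1$ and $\deg P^\sigma_{y,w}\le(l(w)-l(y)-1)/2$ for all $y\in\mathbf{I}_*$, $y<w$. This defines the polynomials $P^\sigma_{y,w}$. $P_{y,w}\in\mathbf{Z}[u]$ ($y\le w$ in $W$) are the usual Kazhdan–Lusztig polynomials of $(W,S)$ in the variable $q=u=v^2$: for the Hecke algebra over $\underline{\mathcal{A}}$ with basis $t_w$, $t_wt_{w'}=t_{ww'}$ if $l(ww')=l(w)+l(w')$, $(t_s+1)(t_s-v^2)=0$ for $s\in S$, and bar involution $\overline{v^nt_x}=v^{-n}t_{x^{-1}}^{-1}$,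 the element $v^{-l(w)}\sum_{y\le w}P_{y,w}t_y$ is bar-invariant, $P_{w,w}=1$, and $\deg_u P_{y,w}\le(l(w)-l(y)-1)/2$ for $y<w$. *)

(* Defs.v *)
From Stdlib Require Export Relation_Operators.
From HB Require Export structures.
From mathcomp Require Export all_boot all_order all_algebra all_fingroup.
From mathcomp Require Export finmap.
From mathcomp Require Export boolp classical_sets functions cardinality fsbigop.

Set Implicit Arguments.
Unset Strict Implicit.
Unset Printing Implicit Defensive.

Import GRing.Theory.

Local Open Scope classical_set_scope.
Local Open Scope ring_scope.

(** * Coxeter systems *)

Section Coxeter.
Variables (W : groupType) (S : set W).

Definition is_expression (r : seq W) (w : W) : Prop :=
  (forall s, s \in r -> S s) /\ (\prod_(s <- r) s)%g = w.

(* (W, S) is a Coxeter system in the sense of Bourbaki: S consists of elements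
   of order 2 and generates W, and W is presented by the generators S and the
   relations (s t)^m = 1 where m is the order of s t, when finite.  The last
   item is the universal property of that presentation; requiring the relation
   for every exponent n with (s t)^n = 1 is the same as requiring it for the
   order of s t.  Only the values of f on S matter.  S may be infinite. *)
Definition coxeter_system : Prop :=
  [/\ forall s, S s -> s <> 1%g /\ (s * s)%g = 1%g,
      forall w, exists r, is_expression r w
    & forall (G : groupType) (f : W -> G),
        (forall s t n, S s -> S t ->
           ((s * t) ^+ n)%g = 1%g -> ((f s * f t) ^+ n)%g = 1%g) ->
        exists g : {multiplicative W -> G}, forall s, S s -> g s = f s].

Definition cox_length (w : W) : nat :=
  xget 0%N [set n | (exists2 r, is_expression r w & size r = n) /\
                    forall r, is_expression r w -> (n <= size r)%N].

Definition cox_reflection (t : W) : Prop :=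
  exists s x, S s /\ t = (x * s * x^-1)%g.

Definition bruhat : W -> W -> Prop :=
  clos_refl_trans W (fun x y =>
    exists t, [/\ cox_reflection t, y = (x * t)%g
                & (cox_length x < cox_length y)%N]).

Definition bruhat_lt (x y : W) : Prop := bruhat x y /\ x <> y.

End Coxeter.

Definition twisted_involutions (W : groupType) (star : W -> W) : set W :=
  [set w | ((star w)^-1)%g = w].

(** * Bases, Laurent polynomials, extension of scalars *)

(* The family (e i), for i in D, is an R-basis of V, where R acts on V through
   [scale]; the values of e outside D are irrelevant. *)
Definition is_basis (R : pzRingType) (V : zmodType) (scale : R -> V -> V)
    (I : choiceType) (D : set I) (e : I -> V) : Prop :=
  forall x : V, exists! c : {fsfun I -> R with 0},
    (forall i, i \in finsupp c -> D i) /\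
    x = \sum_(i <- finsupp c) scale (c i) (e i).

(* A = Z[z, z^-1] with z an indeterminate *)
Definition is_laurent_ring (A : comUnitRingType) (z : A) : Prop :=
  z \is a GRing.unit /\
  is_basis (fun (n : int) (x : A) => x *~ n) [set: int] (fun n : int => z ^ n).

(* iota exhibits MB as the extension of scalars B (x)_A M along phi, by the
   universal property of the tensor product; A acts on M through [scale]. *)
Definition is_scalar_extension (A B : comUnitRingType) (phi : A -> B)
    (M : zmodType) (scale : A -> M -> M) (MB : lmodType B)
    (iota : {additive M -> MB}) : Prop :=
  (forall c m, iota (scale c m) = phi c *: iota m) /\
  forall (N : lmodType B) (f : {additive M -> N}),
    (forall c m, f (scale c m) = phi c *: f m) ->
    exists! g : MB -> N, linear g /\ forall m, g (iota m) = f m.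

(** * Hecke algebras *)

Section Hecke.
Variables (W : groupType) (S : set W).
Variables (R : comUnitRingType) (H : unitAlgType R).

Record is_hecke_algebra (q : R) (T : W -> H) : Prop := HeckeAlgebra {
  hecke_basis : is_basis (fun (c : R) (h : H) => c *: h) [set: W] T;
  hecke_one : T 1%g = 1;
  hecke_mul : forall w w',
    cox_length S (w * w')%g = (cox_length S w + cox_length S w')%N ->
    T w * T w' = T (w * w')%g;
  hecke_quadratic : forall s, S s -> (T s + 1) * (T s - q%:A) = 0 }.

Record is_hecke_bar (z : R) (T : W -> H) (bar : {rmorphism H -> H}) : Prop :=
  HeckeBar {
    hecke_barK : involutive bar;
    hecke_barE : forall (n : int) x,
      bar (z ^ n *: T x) = z ^ (- n) *: (T x^-1%g)^-1 }.

(* The family P, where P y w stands for P_{y,w}; only its values at pairs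
   y <= w are constrained.  The sum is finite because Bruhat intervals are. *)
Record is_KL_family (v : R) (T : W -> H) (bar : H -> H)
    (P : W -> W -> {poly int}) : Prop := KLFamily {
  KL_bar : forall w,
    let C := v ^ (- (cox_length S w)%:Z) *:
      \sum_(y \in [set y | bruhat S y w]) (map_poly intr (P y w)).[v ^+ 2] *: T y
    in bar C = C;
  KL_diag : forall w, P w w = 1;
  KL_deg : forall y w, bruhat_lt S y w ->
    ((size (P y w)).-1.*2 <= cox_length S w - cox_length S y - 1)%N }.

End Hecke.

(** * The module spanned by the twisted involutions *)

Section InvolutionModule.
Variables (W : groupType) (S : set W) (star : W -> W).
Local Notation I_ := (twisted_involutions star).

Record is_involution_module (A : comUnitRingType) (u : A) (H : unitAlgType A)
    (T : W -> H) (M : lmodType H) (a : W -> M) : Prop := InvolutionModule {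
  inv_basis : is_basis (fun (c : A) (m : M) => c%:A *: m) I_ a;
  inv_comm_up : forall s w, S s -> I_ w ->
    (s * w)%g = (w * star s)%g -> bruhat_lt S w (s * w)%g ->
    T s *: a w = u%:A *: a w + (u + 1)%:A *: a (s * w)%g;
  inv_comm_down : forall s w, S s -> I_ w ->
    (s * w)%g = (w * star s)%g -> bruhat_lt S (s * w)%g w ->
    T s *: a w = (u ^+ 2 - u - 1)%:A *: a w + (u ^+ 2 - u)%:A *: a (s * w)%g;
  inv_noncomm_up : forall s w, S s -> I_ w ->
    (s * w)%g <> (w * star s)%g -> bruhat_lt S w (s * w)%g ->
    T s *: a w = a (s * w * star s)%g;
  inv_noncomm_down : forall s w, S s -> I_ w ->
    (s * w)%g <> (w * star s)%g -> bruhat_lt S (s * w)%g w ->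
    T s *: a w =
      (u ^+ 2 - 1)%:A *: a w + (u ^+ 2)%:A *: a (s * w * star s)%g }.

Record is_involution_bar (H : pzRingType) (barH : H -> H) (M : lmodType H)
    (a : W -> M) (barM : {additive M -> M}) : Prop := InvolutionBar {
  inv_barZ : forall (h : H) (m : M), barM (h *: m) = barH h *: barM m;
  inv_bar1 : barM (a 1%g) = a 1%g }.

(* As for [is_KL_family], but indexed by twisted involutions, in the extended
   module MB; u = v^2 there, and ab y is the image of a_y. *)
Record is_sigma_family (B : comUnitRingType) (v : B) (MB : lmodType B)
    (ab : W -> MB) (bar : MB -> MB) (P : W -> W -> {poly int}) : Prop :=
  SigmaFamily {
  sigma_bar : forall w, I_ w ->
    let C := v ^ (- (cox_length S w)%:Z) *:
      \sum_(y \in [set y | I_ y /\ bruhat S y w])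
         (map_poly intr (P y w)).[v ^+ 2] *: ab y
    in bar C = C;
  sigma_diag : forall w, I_ w -> P w w = 1;
  sigma_deg : forall y w, I_ y -> I_ w -> bruhat_lt S y w ->
    ((size (P y w)).-1.*2 <= cox_length S w - cox_length S y - 1)%N }.

End InvolutionModule.

(* Main.v *)
(** Let tau be the anti-automorphism of the Hecke algebra with parameter q = u
    sending t_w to t_{w'}, where w' is the inverse of star w.  Modulo 2, the
    Tate cohomology {h : tau h = h} / {g + tau g} has the classes of t_w, w in
    I_*, as a basis, and h . m = h m tau(h) defines on it an action of the Hecke
    algebra with parameter u^2: the map is additive in h up to g + tau g, and it
    is Frobenius-semilinear.  Computing t_s t_w tau(t_s) shows that this module
    is M modulo 2, with a_w corresponding to t_w, and both bar operators agree
    since they fix a_1 = t_1.  Bar-invariance of A_w then says that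
    v^{-l(w)} sum P^sigma_{y,w} t_y is bar-invariant in Tate cohomology.  So is
    the Kazhdan-Lusztig element C_w, in which the terms with y not in I_* cancel
    because P_{y,w} = P_{y',w}; the degree bounds determine such an element
    uniquely, whence the congruence. *)
Require Import Defs.
From mathcomp Require Import zify ring.

Set Implicit Arguments.
Unset Strict Implicit.
Unset Printing Implicit Defensive.

Import GRing.Theory.

Local Open Scope classical_set_scope.
Local Open Scope ring_scope.

(** * Strong exchange in Coxeter groups *)

Section ReflectionCocycleGroup.
Local Open Scope group_scope.
Variable W : groupType.

(** Subsets of [W] under symmetric difference, with [W] acting by conjugation. Indexing by all of
    [W] instead of the reflections avoids a subtype. *)
Definition cocycle_group : Type := (W * (W -> bool))%type.

HB.instance Definition _ := Choice.copy cocycle_group (W * (W -> bool))%type.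

Definition cocycle_mul (a b : cocycle_group) : cocycle_group :=
  (a.1 * b.1, fun t => a.2 (b.1 * t * b.1^-1) (+) b.2 t).
Definition cocycle_one : cocycle_group := (1, fun=> false).
Definition cocycle_inv (a : cocycle_group) : cocycle_group :=
  (a.1^-1, fun t => a.2 (a.1^-1 * t * a.1)).

Lemma cocycle_eq (a b : cocycle_group) : a.1 = b.1 -> a.2 =1 b.2 -> a = b.
Proof. by case: a b => [w A] [w' A'] /= -> /funext ->. Qed.

Lemma cocycle_mulA : associative cocycle_mul.
Proof.
move=> a b c; apply: cocycle_eq => [|t] /=; first exact: mulgA.
by rewrite addbA invgM !mulgA.
Qed.

Lemma cocycle_mul1 : left_id cocycle_one cocycle_mul.
Proof. by move=> a; apply: cocycle_eq => //=; exact: mul1g. Qed.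

Lemma cocycle_mulr1 : right_id cocycle_one cocycle_mul.
Proof.
move=> a; apply: cocycle_eq => [|t] /=; first exact: mulg1.
by rewrite mul1g invg1 mulg1 addbF.
Qed.

Lemma cocycle_mulV : left_inverse cocycle_one cocycle_inv cocycle_mul.
Proof.
move=> a; apply: cocycle_eq => [|t] /=; first exact: mulVg.
by rewrite !mulgA mulVg mul1g mulgKV addbb.
Qed.

Lemma cocycle_mulrV : right_inverse cocycle_one cocycle_inv cocycle_mul.
Proof.
move=> a; apply: cocycle_eq => [|t] /=; first exact: mulgV.
by rewrite invgK addbb.
Qed.

HB.instance Definition _ := isGroup.Build cocycle_group cocycle_mulA
  cocycle_mul1 cocycle_mulr1 cocycle_mulV cocycle_mulrV.

End ReflectionCocycleGroup.

(** * Length function and exchange condition *)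

Section Coxeter.
Local Open Scope group_scope.
Variables (W : groupType) (S : set W).
Hypothesis hW : coxeter_system S.
Local Notation l := (cox_length S).
Implicit Types (w x y t s : W) (r : seq W).

Lemma simple_sq s : S s -> s * s = 1.
Proof. by case: hW => hS _ _ /hS[]. Qed.

Lemma simple_inv s : S s -> s^-1 = s.
Proof. by move=> Ss; apply: (mulgI s); rewrite mulgV simple_sq. Qed.

Lemma simpleK s w : S s -> s * (s * w) = w.
Proof. by move=> Ss; rewrite mulgA simple_sq// mul1g. Qed.

Lemma simpleKr s w : S s -> w * s * s = w.
Proof. by move=> Ss; rewrite -mulgA simple_sq// mulg1. Qed.

Lemma expression_nil : is_expression S [::] 1.
Proof. by split=> //; rewrite big_nil. Qed.

Lemma expression_simple s : S s -> is_expression S [:: s] s.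
Proof. by move=> Ss; split=> [x|]; rewrite ?inE ?big_seq1// => /eqP ->. Qed.

Lemma expression_cat r r' x y :
  is_expression S r x -> is_expression S r' y -> is_expression S (r ++ r') (x * y).
Proof.
move=> [rS <-] [r'S <-]; split; last by rewrite big_cat.
by move=> s; rewrite mem_cat => /orP[/rS|/r'S].
Qed.

Lemma expression_consP s r w :
  is_expression S (s :: r) w <-> S s /\ is_expression S r (s^-1 * w).
Proof.
split=> [[rS <-]|[Ss rw]]; last first.
  by rewrite -(mulKVg s w); apply: (expression_cat (expression_simple Ss) rw).
split; first by apply: rS; rewrite mem_head.
split; last by rewrite big_cons mulKg.
by move=> x xr; apply: rS; rewrite inE xr orbT.
Qed.

Lemma expression_rev r x : is_expression S r x -> is_expression S (rev r) x^-1.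
Proof.
elim: r x => [x [_ <-]|s r IH x /expression_consP[Ss /IH]].
  by rewrite big_nil invg1; exact: expression_nil.
move=> rx; rewrite rev_cons -cats1 -[x^-1](mulgKV s).
apply: expression_cat; last exact: expression_simple.
by move: rx; rewrite invgM invgK (simple_inv Ss).
Qed.

Lemma length_spec w : (exists2 r, is_expression S r w & size r = l w) /\
  forall r, is_expression S r w -> (l w <= size r)%N.
Proof.
rewrite /cox_length.
pose Q n := `[< exists2 r, is_expression S r w & size r = n >].
have Qex : exists n, Q n.
  by case: hW => _ /(_ w)[r rw] _; exists (size r); apply/asboolP; exists r.
case: (ex_minnP Qex) => n /asboolP Qn nmin.
apply: (@xgetPex _ 0%N [set n | (exists2 r, is_expression S r w & size r = n) /\
                    forall r, is_expression S r w -> (n <= size r)%N]).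
by exists n; split=> // r rw; apply: nmin; apply/asboolP; exists r.
Qed.

Lemma reduced_expression w : exists2 r, is_expression S r w & size r = l w.
Proof. by have [] := length_spec w. Qed.

Lemma length_le r w : is_expression S r w -> (l w <= size r)%N.
Proof. by have [_] := length_spec w; exact. Qed.

Lemma length1 : l 1 = 0%N.
Proof. by apply/eqP; rewrite -leqn0 (length_le expression_nil). Qed.

Lemma length_eq0 w : l w = 0%N -> w = 1.
Proof.
move=> l0; have [r rw] := reduced_expression w.
by rewrite l0 => /size0nil r0; case: rw => _ <-; rewrite r0 big_nil.
Qed.

Lemma length_mul x y : (l (x * y) <= l x + l y)%N.
Proof.
have [r rx <-] := reduced_expression x; have [r' ry <-] := reduced_expression y.
by rewrite -size_cat; apply/length_le/expression_cat.
Qed.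

Lemma length_inv x : l x^-1 = l x.
Proof.
suff le y : (l y^-1 <= l y)%N.
  by apply/eqP; rewrite eqn_leq le /=; have := le x^-1; rewrite invgK.
have [r rx <-] := reduced_expression y.
by rewrite -size_rev; apply/length_le/expression_rev.
Qed.

Lemma length_simple s : S s -> l s = 1%N.
Proof.
move=> Ss; have := length_le (expression_simple Ss); rewrite leq_eqVlt.
case/orP => [/eqP//|]; rewrite ltnS leqn0 => /eqP/length_eq0 s1.
by case: hW => hS _ _; case: (hS s Ss).
Qed.

(** Removing the first letter of a reduced expression leaves a reduced expression. *)
Lemma length_ind (P : W -> Prop) : P 1 ->
  (forall s w, S s -> P w -> l (s * w) = (l w).+1 -> P (s * w)) ->
  forall w, P w.
Proof.
move=> P1 PS w; move: {2}(l w) (erefl (l w)) => n.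
elim: n w => [w /length_eq0 -> //|n IH w lw].
have [[|s r] rw] := reduced_expression w; rewrite lw // => -[sr].
case/expression_consP: (rw) => Ss rsw; rewrite -(mulKVg s w).
have lsw : l (s^-1 * w) = n.
  have := length_mul s (s^-1 * w).
  rewrite mulKVg (length_simple Ss) lw add1n ltnS => ge.
  by apply/eqP; rewrite eqn_leq ge -{1}sr (length_le rsw).
by apply: PS => //; [exact: IH | rewrite mulKVg lsw].
Qed.

(** The sum runs over [2n] consecutive terms of a sequence of period [n], so each term occurs twice.
    This is the parity check for a dihedral relation. *)
Lemma bigxor_dihedral (f : nat -> bool) n :
  (forall i, f (n + i)%N = f i) ->
  \big[addb/false]_(0 <= i < n) (f i.*2.+1 (+) f i.*2) = false.
Proof.
move=> fn.
have -> : \big[addb/false]_(0 <= i < n) (f i.*2.+1 (+) f i.*2)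
   = \big[addb/false]_(0 <= i < n.*2) f i.
  elim: n {fn} => [|n IH]; first by rewrite !big_nil.
  by rewrite doubleS !big_nat_recr//= IH -addbA [f _.+1 (+) _]addbC.
rewrite -addnn (@big_cat_nat _ _ _ n)//= ?leq_addr//.
rewrite -{2}[n]add0n big_addn addnK.
by under [X in _ (+) X]eq_bigr do rewrite addnC fn; rewrite addbb.
Qed.

Lemma cocycle_expg (a : cocycle_group W) n :
  a ^+ n = (a.1 ^+ n,
    fun t => \big[addb/false]_(0 <= i < n) a.2 (a.1 ^+ i * t * a.1 ^- i)).
Proof.
elim: n => [|n IH].
  by rewrite expg0; apply: cocycle_eq => [|t] /=; rewrite ?expg0 ?big_nil.
rewrite expgSr IH; apply: cocycle_eq => [|t] /=; first by rewrite expgSr.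
rewrite big_nat_recl//= expg0 invg1 mul1g mulg1 addbC.
congr addb; apply: eq_bigr => i _.
by rewrite expgSr invgM !mulgA.
Qed.

(* [N w t] is the parity of the number of times the reflection t is met along
   an expression of w; it comes from the universal property applied to the
   semidirect product of W with the group of subsets of W. *)
Lemma reflection_cocycle : exists N : W -> W -> bool,
  (forall x y t, N (x * y) t = N x (y * t * y^-1) (+) N y t) /\
  (forall s t, S s -> N s t = (t == s)).
Proof.
case: hW => hS hgen /(_ (cocycle_group W) (fun s => (s, fun t => t == s))).
case=> [s s' n Ss Ss' ssn|g gS].
  rewrite cocycle_expg; apply: cocycle_eq => [|t] /=; first exact: ssn.
  set c := s * s'.
  have s'c : s' * c^-1 = c * s'.
    by rewrite /c invgM mulKVg simpleKr// (simple_inv Ss).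
  have s'ci i : s' * c ^- i = c ^+ i * s'.
    elim: i => [|i IH]; first by rewrite expg0 invg1 mulg1 mul1g.
    by rewrite {1}expgSr invgM mulgA s'c -mulgA IH mulgA -expgS.
  (* [f] tests [t] against the reflections of the dihedral group of [s], [s']: even indices come
     from the letters [s'] of [(s s')^n], odd ones from the letters [s]. The period [n] is the
     relation [c ^+ n = 1]. *)
  pose f i := (t == c ^- i * s').
  have fE i : f i.*2 = (c ^+ i * t * c ^- i == s').
    rewrite /f -addnn expgnDr invgM -mulgA -(inj_eq (mulgI (c ^+ i))).
    rewrite -(inj_eq (mulIg (c ^- i))) !mulgA mulgV mul1g.
    by rewrite -[c ^- i * s' * _]mulgA s'ci mulKg.
  have fE' i : f i.*2.+1 = (s' * (c ^+ i * t * c ^- i) * s'^-1 == s).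
    rewrite -(inj_eq (mulIg s')) mulgKV -(inj_eq (mulgI s')) simpleK//.
    rewrite /f -addnn -addSn expgnDr invgM -mulgA -(inj_eq (mulgI (c ^+ i))).
    rewrite -(inj_eq (mulIg (c ^- i))) !mulgA mulgV mul1g.
    congr (_ == _).
    rewrite expgSr invgM -!mulgA s'ci mulKg /c invgM.
    by rewrite (simple_inv Ss) (simple_inv Ss') !mulgA.
  rewrite -[RHS](@bigxor_dihedral f n) => [|i].
    by apply: eq_bigr => i _; rewrite fE fE'.
  by rewrite /f expgnDr {1}/c ssn mul1g.
have g1 w : (g w).1 = w.
  elim/length_ind: w => [|s w Ss gw _]; last by rewrite gmulfM /= gw gS.
  have e : g 1 * g 1 = g 1 by rewrite -gmulfM mulg1.
  by rewrite (_ : g 1 = 1)//; apply: (mulgI (g 1)); rewrite e mulg1.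
exists (fun w => (g w).2); split=> [x y t|s t /gS -> //].
by rewrite gmulfM /= g1.
Qed.

(** Write [w = s w']. Either [N w' t] holds and a later letter can be deleted by induction, or
    [w' t w'^-1 = s], and multiplying [w] by [t] deletes the first letter. *)
Lemma cocycle_deletion (N : W -> W -> bool) :
  (forall x y t, N (x * y) t = N x (y * t * y^-1) (+) N y t) ->
  (forall s t, S s -> N s t = (t == s)) ->
  forall r w t, is_expression S r w -> N w t ->
  exists r1 s r2, r = r1 ++ s :: r2 /\ is_expression S (r1 ++ r2) (w * t).
Proof.
move=> NM NS; have N1 t : N 1 t = false.
  by have := NM 1 1 t; rewrite !(mulg1, mul1g, invg1) addbb.
elim=> [w t [_ <-]|s r IH w t]; first by rewrite big_nil N1.
move=> /expression_consP[Ss rw]; rewrite -{1}(mulKVg s w) NM NS//.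
set w' := s^-1 * w in rw *.
case: (boolP (N w' t)) => [/(IH _ _ rw)[r1 [s' [r2 [-> e]]]] _|_].
  exists (s :: r1), s', r2; split=> //; apply/expression_consP; split=> //.
  by rewrite mulgA.
rewrite addbF => /eqP e; exists [::], s, r; split=> //=.
rewrite (_ : w * t = w')//; apply: (mulIg w'^-1); rewrite mulgV.
apply: (mulgI s^-1); rewrite mulg1 !mulgA -/w' e.
by rewrite simple_inv.
Qed.

(** The cocycle takes the value true at [N t t]. If [N w t] failed, [N (w * t) t] would hold, and
    deletion in a reduced expression of [w * t] would make [w] the shorter of the two. *)
Lemma strong_exchange r w t : is_expression S r w -> cox_reflection S t ->
  (l (w * t) < l w)%N ->
  exists r1 s r2, r = r1 ++ s :: r2 /\ is_expression S (r1 ++ r2) (w * t).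
Proof.
have [N [NM NS]] := reflection_cocycle.
have del := cocycle_deletion NM NS.
move=> rw [s [x [Ss tE]]] lt; apply: (del) => //.
have N1 t' : N 1 t' = false.
  by have := NM 1 1 t'; rewrite !(mulg1, mul1g, invg1) addbb.
have tt : t * t = 1 by rewrite tE !mulgA mulgKV simpleKr// mulgV.
have Ntt : N t t.
  have := NM x x^-1 t; rewrite mulgV N1 invgK.
  have -> : x^-1 * t * x = s by rewrite tE !mulgA mulVg mul1g mulgKV.
  have -> : N t t = N (x * s * x^-1) t by rewrite -tE.
  rewrite NM NM (NS s)//.
  have -> : x^-1 * t * x^-1^-1 = s.
    by rewrite invgK tE !mulgA mulVg mul1g mulgKV.
  by rewrite mulgK eqxx; case: (N x s); case: (N x^-1 t).
case: (boolP (N w t)) => // Nw.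
have [r' rwt sr'] := reduced_expression (w * t).
have [] := del r' (w * t) t rwt.
  by rewrite NM mulgK (negbTE Nw) Ntt.
move=> r1 [s' [r2 [r'E]]]; rewrite -mulgA tt mulg1 => /length_le.
rewrite leqNgt => /negP[]; apply: leq_ltn_trans lt.
by rewrite -sr' r'E !size_cat /= addnS.
Qed.

Lemma reflection_simple s : S s -> cox_reflection S s.
Proof. by move=> Ss; exists s, 1; rewrite mul1g invg1 mulg1. Qed.

Lemma reflection_conj x t : cox_reflection S t -> cox_reflection S (x * t * x^-1).
Proof.
by move=> [s [y [Ss ->]]]; exists s, (x * y); split=> //; rewrite invgM !mulgA.
Qed.

(** Exactly one of [N w s] and [N (w * s) s] holds, and deletion then shortens the corresponding
    element. *)
Lemma length_simple_neq w s : S s -> l (w * s) <> l w.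
Proof.
have [N [NM NS]] := reflection_cocycle => Ss lE.
have lt x : N x s -> (l (x * s) < l x)%N.
  have [r rx <-] := reduced_expression x.
  move=> /(cocycle_deletion NM NS rx)[r1 [s' [r2 [-> /length_le]]]].
  by rewrite !size_cat /= addnS.
case: (boolP (N w s)) => [/lt|Nw]; first by rewrite lE ltnn.
have /lt : N (w * s) s by rewrite NM mulgK (NS s)// eqxx addbT.
by rewrite simpleKr// lE ltnn.
Qed.

Lemma length_mulr w s : S s -> l (w * s) = (l w).+1 \/ l w = (l (w * s)).+1.
Proof.
move=> Ss; have /eqP := @length_simple_neq w s Ss.
have := length_mul w s; have := length_mul (w * s) s.
rewrite simpleKr// (length_simple Ss) !addn1 neq_ltn => h1 h2 /orP[] h.
  by right; apply/eqP; rewrite eqn_leq h1.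
by left; apply/eqP; rewrite eqn_leq h2.
Qed.

Lemma length_mull w s : S s -> l (s * w) = (l w).+1 \/ l w = (l (s * w)).+1.
Proof.
move=> Ss; have := length_mulr w^-1 Ss.
by rewrite -length_inv invgM invgK (simple_inv Ss) length_inv.
Qed.

(** If [s'] shortened [s w], exchange would delete a letter of [s :: r]. Deleting [s] gives
    [s w = w s']; deleting a letter of [r] makes [w s'] shorter than [w]. Both are excluded. *)
Lemma length_mull_mulr_up s w s' : S s -> S s' ->
  l (s * w) = (l w).+1 -> l (w * s') = (l w).+1 -> s * w <> w * s' ->
  l (s * w * s') = (l w).+2.
Proof.
move=> Ss Ss' sw ws' ne; case: (length_mulr (s * w) Ss') => [|lt].
  by rewrite sw.
have [r rw sr] := reduced_expression w.
have rsw : is_expression S (s :: r) (s * w).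
  by apply/expression_consP; rewrite mulKg.
have [|[|x r1] [s0 [r2 [/= [sE rE] e]]]] :=
    strong_exchange rsw (reflection_simple Ss'); first by rewrite lt.
  case: ne; rewrite -[s * w](simpleKr _ Ss'); congr (_ * _).
  by case: e => _ <-; case: rw => _ <-; rewrite rE.
rewrite -sE in e; case/expression_consP: e => _ /length_le.
rewrite !mulgA mulVg mul1g ws' -sr rE !size_cat /= addnS.
by rewrite ltnNge leqnSn.
Qed.

Lemma length_mull_mulr_down s w s' : S s -> S s' ->
  l w = (l (s * w)).+1 -> l w = (l (w * s')).+1 -> s * w <> w * s' ->
  l w = (l (s * w * s')).+2.
Proof.
move=> Ss Ss' sw ws' ne; case: (length_mulr (s * w) Ss') => [up|]; last first.
  by move=> lt; rewrite sw lt.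
have e : w <> s * w * s' by move=> e; apply: ne; rewrite {2}e simpleKr.
have := @length_mull_mulr_up s (s * w) s' Ss Ss'.
rewrite !simpleK// => /(_ sw up e) /eqP.
by move: sw; rewrite ws' => -[->]; rewrite eqn_leq ltnNge leqnSn andbF.
Qed.

(** * Bruhat order: length and finiteness of lower intervals *)

Lemma bruhat_lt_length x w : bruhat_lt S x w -> (l x < l w)%N.
Proof.
case=> xw; suff : x = w \/ (l x < l w)%N by case.
elim: xw => [y z [t [_ _ ?]]|y|y z u _ h1 _ h2]; [by right|by left|].
case: h1 => [->//|h1]; case: h2 => [<-|h2]; first by right.
by right; apply: ltn_trans h1 h2.
Qed.

Lemma bruhat_lt_mull w s : S s -> l (s * w) = (l w).+1 ->
  bruhat_lt S w (s * w).
Proof.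
move=> Ss lw; split; last by move=> e; move: lw; rewrite -e => /n_Sn.
apply: rt_step; exists (w^-1 * s * w); split; last by rewrite lw.
  by rewrite -{2}[w]invgK; apply/reflection_conj/reflection_simple.
by rewrite !mulgA mulgV mul1g.
Qed.

(** By strong exchange, every element below [w] is the product of a subword of one fixed expression
    of [w]; subwords are indexed by boolean masks. *)
Lemma bruhat_finite w : finite_set [set y | bruhat S y w].
Proof.
have [r rw _] := reduced_expression w.
have sub y : bruhat S y w -> exists2 r', subseq r' r & is_expression S r' y.
  move=> yw.
  suff : exists2 r', subseq r' r & is_expression S r' y by [].
  have : exists2 r', subseq r' r & is_expression S r' w by exists r.
  elim: yw => [x z [t [tref -> lt]] [r' r'r r'z]|//|x z u _ h1 _ h2 /h2/h1//].
  have tt : t * t = 1.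
    by have [s [z' [Ss ->]]] := tref; rewrite !mulgA mulgKV simpleKr// mulgV.
  have := strong_exchange r'z tref; rewrite -mulgA tt mulg1 => /(_ lt).
  case=> r1 [s [r2 [r'E e]]]; exists (r1 ++ r2) => //.
  apply: subseq_trans r'r; rewrite r'E; apply: cat_subseq => //.
  exact: subseq_cons.
pose f m := \prod_(s <- mask m r) s.
apply: (@sub_finite_set _ _ [set` [seq f (val m) | m : (size r).-tuple bool]]).
  move=> y /sub[r' /subseqP[m sm ->] [_ <-]] /=.
  apply/mapP; exists (tcast sm (in_tuple m)); first by rewrite mem_enum.
  by rewrite val_tcast.
exact: finite_seq.
Qed.

End Coxeter.

(** * Bases and Laurent polynomials *)

Section Basis.
Variables (R : pzRingType) (V : zmodType) (scale : R -> V -> V).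
Variables (I : choiceType) (D : set I) (e : I -> V).
Hypothesis he : is_basis scale D e.

Lemma basis_ind (P : V -> Prop) :
  P 0 -> (forall x y, P x -> P y -> P (x + y)) ->
  (forall i c, D i -> P (scale c (e i))) -> forall x, P x.
Proof.
move=> P0 PD PS x; have [c [[cD ->] _]] := he x.
by rewrite big_seq; apply: big_ind => // i /cD; exact: PS.
Qed.

(** [F] need only be additive in the coefficient, so the extension covers semilinear maps as well as
    linear ones. *)
Lemma basis_ext (N : zmodType) (F : I -> R -> N) :
  (forall x c d, scale (c + d) x = scale c x + scale d x) ->
  (forall i c d, F i (c + d) = F i c + F i d) ->
  exists g : {additive V -> N}, forall i c, D i -> g (scale c (e i)) = F i c.
Proof.
move=> scaleD FD.
have scale0 x : scale 0 x = 0.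
  by apply: (addrI (scale 0 x)); rewrite -scaleD !addr0.
have F0 i : F i 0 = 0 by apply: (addrI (F i 0)); rewrite -FD !addr0.
have [c cP] := choice he.
pose g x := \sum_(i <- finsupp (c x)) F i (c x i).
(* Coordinates have exact support, but adding two expansions may create zero coefficients; [g] is
   therefore evaluated on expansions over any finite set. *)
have gE (A : {fset I}) (f : I -> R) : (forall i, i \in A -> D i) ->
    g (\sum_(i <- A) scale (f i) (e i)) = \sum_(i <- A) F i (f i).
  move=> AD; set x := \sum_(i <- A) _.
  pose d : {fsfun I -> R with 0} := [fsfun i in A => f i].
  have dE i : i \in A -> d i = f i by move=> iA; rewrite fsfunE iA.
  have dA : (finsupp d `<=` A)%fset by exact: finsupp_sub.
  have d0 i : i \notin finsupp d -> d i = 0 by move=> /fsfun_dflt.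
  have cd : c x = d.
    apply: (cP x).2; split=> [i /(fsubsetP dA)/AD//|].
    rewrite (big_fset_incl _ dA) => [|i iA /d0 ->]; last exact: scale0.
    by apply: eq_big_seq => i /dE ->.
  rewrite /g cd (big_fset_incl _ dA) => [|i iA /d0 -> //].
  by apply: eq_big_seq => i /dE ->.
have gD : zmod_morphism g.
  suff gD x y : g (x + y) = g x + g y.
    by move=> x y; apply: (addIr (g y)); rewrite -gD !subrK.
  have [[xD xE] _] := cP x; have [[yD yE] _] := cP y.
  pose A := (finsupp (c x) `|` finsupp (c y))%fset.
  have AD i : i \in A -> D i by rewrite inE => /orP[/xD|/yD].
  have E z : (finsupp (c z) `<=` A)%fset ->
      z = \sum_(i <- finsupp (c z)) scale (c z i) (e i) ->
      z = \sum_(i <- A) scale (c z i) (e i).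
    move=> zA {1}->; apply: big_fset_incl => // i _ /fsfun_dflt ->.
    exact: scale0.
  have xE' := E x (fsubsetUl _ _) xE; have yE' := E y (fsubsetUr _ _) yE.
  rewrite {1}xE' {1}yE' -big_split /=.
  under eq_bigr do rewrite -scaleD.
  rewrite gE// {2}xE' {2}yE' !gE// -big_split /=.
  by apply: eq_bigr => i _; rewrite FD.
exists (HB.pack_for {additive V -> N} g (GRing.isZmodMorphism.Build V N g gD)).
move=> i b Di /=; have := gE [fset i]%fset (fun=> b).
by rewrite !big_seq_fset1; apply=> j; rewrite inE => /eqP ->.
Qed.

End Basis.

(** * Divisibility by integers of polynomials and Laurent polynomials *)

Lemma poly_divn (k : nat) (p : {poly int}) :
  (forall i, exists q, p`_i = q *+ k) -> exists q, p = q *+ k.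
Proof.
move=> /choice[q qE]; exists (\poly_(i < size p) q i).
apply/polyP => i; rewrite coefMn coef_poly.
by case: ltnP => [_|/(nth_default 0) ->]; rewrite ?qE ?mul0rn.
Qed.

(** The constant term of [1 + 'X^2] is 1, so the coefficients of [p] are even one after another,
    from the lowest degree up. *)
Lemma poly_even_factor (p r : {poly int}) :
  p * (1 + 'X^2) = r *+ 2 -> exists q, p = q *+ 2.
Proof.
move=> pr; apply: poly_divn => i; elim/ltn_ind: i => i IH.
have := congr1 (fun x : {poly int} => x`_i) pr.
rewrite mulrDr mulr1 coefD coefMXn coefMn; case: ltnP => [_|i2].
  by rewrite addr0 => ->; exists r`_i.
have [|q ->] := IH (i - 2)%N; first by rewrite ltn_subrL (ltnW i2).
by move=> /(canRL (addrK _)) ->; exists (r`_i - q); rewrite mulrnBl.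
Qed.

Section Laurent.
Variables (A : comUnitRingType) (z : A).
Hypothesis hA : is_laurent_ring z.

Lemma laurent_unit : z \is a GRing.unit. Proof. by case: hA. Qed.

Lemma laurent_ind (P : A -> Prop) :
  (forall x y, P x -> P y -> P (x + y)) ->
  (forall (n k : int), P (z ^ n *~ k)) -> forall x, P x.
Proof.
move=> PD PZ; case: hA => _ hz; apply: (basis_ind hz) => //.
exact: (PZ 0 0).
Qed.

Lemma laurent_coef : exists f : int -> {additive A -> int},
  forall j n k, f j (z ^ n *~ k) = if n == j then k else 0.
Proof.
case: hA => _ hz.
suff /choice[f fE] : forall j : int, exists f : {additive A -> int},
  forall n k, f (z ^ n *~ k) = if n == j then k else 0 by exists f.
move=> j.
have [| |g gE] := basis_ext (F := fun n k => if n == j then k else 0 : int) hz.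
- by move=> x c d; rewrite mulrzDr.
- by move=> i c d; case: (i == j); rewrite ?addr0.
by exists g => n k; rewrite gE.
Qed.

Lemma horner_intr_sum (p : {poly int}) (x : A) :
  (map_poly intr p).[x] = \sum_(i < size p) x ^+ i *~ p`_i.
Proof.
by rewrite horner_poly; apply: eq_bigr => i _; rewrite mulrzl.
Qed.

Lemma laurent_divn (k : nat) (p : {poly int}) b :
  (map_poly intr p).[z] = b *+ k -> exists q, p = q *+ k.
Proof.
have [f fE] := laurent_coef => pb; apply: poly_divn => i.
exists (f i b); rewrite -raddfMn -pb horner_intr_sum raddf_sum /=.
under eq_bigr do rewrite exprnP fE eqz_nat.
have [ltip|leip] := ltnP i (size p); last first.
  rewrite nth_default// big1// => j _; case: eqP => // e.
  by have := ltn_ord j; rewrite e ltnNge leip.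
rewrite (bigD1 (Ordinal ltip))//= eqxx big1 ?addr0// => j.
by rewrite -val_eqE /= => /negbTE ->.
Qed.

Lemma laurent_numerator x : exists n p, x * z ^+ n = (map_poly intr p).[z].
Proof.
have zU := laurent_unit.
elim/laurent_ind: x => [x y [n [p xE]] [m [r yE]]|n k].
  exists (n + m)%N, (p * 'X^m + r * 'X^n).
  rewrite rmorphD !rmorphM /= !map_polyXn hornerD !hornerM !hornerXn -xE -yE.
  by rewrite mulrDl exprD !mulrA [y * _ * _]mulrAC.
case: n => n.
  exists 0%N, (k%:P * 'X^n); rewrite expr0 mulr1 -mulrzl.
  by rewrite rmorphM /= map_polyC map_polyXn hornerM hornerC hornerXn.
exists n.+1, (k%:P).
by rewrite map_polyC hornerC NegzE mulrzAl -exprnN mulVr ?unitrX.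
Qed.

(** Clearing denominators reduces this to polynomials. It later removes the powers of [1 + v ^+ 2]
    allowed in [tate_null]. *)
Lemma laurent_even_factor x b :
  (1 + z ^+ 2) * x = b *+ 2 -> exists y, x = y *+ 2.
Proof.
have [n [p pE]] := laurent_numerator x => xb.
have [r prE] : exists r, p * (1 + 'X^2) = r *+ 2.
  apply: (@laurent_divn 2 _ (b * z ^+ n)).
  rewrite rmorphM rmorphD rmorph1 /= map_polyXn hornerM hornerD hornerC hornerXn.
  by rewrite -pE mulrC mulrA xb mulrnAl.
have [q qE] := poly_even_factor prE.
exists ((map_poly intr q).[z] * z ^- n).
have zU : z ^+ n \is a GRing.unit by rewrite unitrX ?laurent_unit.
apply: (mulIr zU); rewrite pE qE rmorphMn hornerMn.
by rewrite mulrnAl mulrVK.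
Qed.

End Laurent.

(** * Hecke algebras and uniqueness of Kazhdan-Lusztig elements *)

Section Hecke.
Variables (W : groupType) (S : set W).
Hypothesis hW : coxeter_system S.
Variables (R : comUnitRingType) (q : R) (H : unitAlgType R) (T : W -> H).
Hypothesis (hT : is_hecke_algebra S q T) (qU : q \is a GRing.unit).
Local Notation l := (cox_length S).

Lemma hecke_ind (P : H -> Prop) : P 0 ->
  (forall x y, P x -> P y -> P (x + y)) -> (forall c w, P (c *: T w)) ->
  forall h, P h.
Proof. by move=> P0 PD PT; apply: (basis_ind (hecke_basis hT)). Qed.

Lemma hecke_ext (N : zmodType) (F : W -> R -> N) :
  (forall w c d, F w (c + d) = F w c + F w d) ->
  exists g : {additive H -> N}, forall w c, g (c *: T w) = F w c.
Proof.
move=> FD; have [|//|g gE] := basis_ext (F := F) (hecke_basis hT).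
  by move=> x c d; rewrite scalerDl.
by exists g => w c; rewrite gE.
Qed.

Lemma hecke_coef : exists f : W -> {additive H -> R},
  (forall y c h, f y (c *: h) = c * f y h) /\
  (forall y w, f y (T w) = (w == y)%:R).
Proof.
suff /choice[f fE] : forall y, exists f : {additive H -> R},
  (forall c h, f (c *: h) = c * f h) /\ (forall w, f (T w) = (w == y)%:R).
  by exists f; split=> y; case: (fE y).
move=> y.
have [|g gE] := hecke_ext (F := fun w c => c * (w == y)%:R).
  by move=> w c d; rewrite mulrDl.
exists g; split=> [c h|w]; last by rewrite -[T w]scale1r gE mul1r.
elim/hecke_ind: h => [|x z gx gz|d w].
- by rewrite scaler0 !raddf0 mulr0.
- by rewrite scalerDr !raddfD gx gz mulrDr.
- by rewrite scalerA !gE mulrA.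
Qed.

Lemma hecke_mull_up s w : S s -> l (s * w)%g = (l w).+1 ->
  T s * T w = T (s * w)%g.
Proof. by move=> Ss lw; rewrite (hecke_mul hT)// lw (length_simple hW Ss). Qed.

Lemma hecke_mulr_up s w : S s -> l (w * s)%g = (l w).+1 ->
  T w * T s = T (w * s)%g.
Proof.
by move=> Ss lw; rewrite (hecke_mul hT)// lw (length_simple hW Ss) addn1.
Qed.

Lemma hecke_sq s : S s -> T s * T s = (q - 1) *: T s + q%:A.
Proof.
move=> /(hecke_quadratic hT)/eqP; rewrite mulrDl mul1r mulrBr -scalerAr mulr1.
rewrite addr_eq0 subr_eq opprB => /eqP ->.
by rewrite scalerBl scale1r -addrA [- T s + _]addrC addrC.
Qed.

Lemma hecke_mull_down s w : S s -> l w = (l (s * w)%g).+1 ->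
  T s * T w = (q - 1) *: T w + q *: T (s * w)%g.
Proof.
move=> Ss lw; have := @hecke_mull_up s (s * w)%g Ss.
rewrite (simpleK hW)// => /(_ lw) <-.
by rewrite mulrA hecke_sq// mulrDl -!scalerAl mul1r.
Qed.

Lemma hecke_mulr_down s w : S s -> l w = (l (w * s)%g).+1 ->
  T w * T s = (q - 1) *: T w + q *: T (w * s)%g.
Proof.
move=> Ss lw; have := @hecke_mulr_up s (w * s)%g Ss.
rewrite (simpleKr hW)// => /(_ lw) <-.
by rewrite -mulrA hecke_sq// mulrDr -!scalerAr mulr1.
Qed.

Lemma hecke_simple_inv s : S s ->
  T s \is a GRing.unit /\ (T s)^-1 = q^-1 *: T s + (q^-1 - 1)%:A.
Proof.
move=> Ss; set x := q^-1 *: T s + (q^-1 - 1)%:A.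
have xT : x * T s = 1.
  rewrite mulrDl -!scalerAl mul1r hecke_sq// scalerDr !scalerA mulVr// scale1r.
  by rewrite addrAC -scalerDl mulrBr mulr1 mulVr// addrA subrK subrr scale0r add0r.
have Tx : T s * x = 1.
  by rewrite -xT mulrDl mulrDr -!scalerAl -!scalerAr mulr1 mul1r.
have U : T s \is a GRing.unit by apply/unitrP; exists x.
by split=> //; apply: (mulIr U); rewrite mulVr.
Qed.

Lemma hecke_unit w : T w \is a GRing.unit.
Proof.
elim/(length_ind hW): w => [|s w Ss wU lw]; first by rewrite (hecke_one hT) unitr1.
by rewrite -hecke_mull_up// unitrMr// (hecke_simple_inv Ss).1.
Qed.

(** The span of the basis elements of length below [n], given by generation so that membership can
    be used by induction. *)
Inductive length_below (n : nat) : H -> Prop :=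
| length_below0 : length_below n 0
| length_belowD x y : length_below n x -> length_below n y ->
    length_below n (x + y)
| length_belowT c w : (l w < n)%N -> length_below n (c *: T w).

Lemma length_belowZ n c h : length_below n h -> length_below n (c *: h).
Proof.
elim=> [|x y _ ? _ ?|d w lw]; first by rewrite scaler0; exact: length_below0.
- by rewrite scalerDr; apply: length_belowD.
- by rewrite scalerA; apply: length_belowT.
Qed.

Lemma length_belowS n h : length_below n h -> length_below n.+1 h.
Proof.
elim=> [|x y _ ? _ ?|d w lw]; first exact: length_below0.
- exact: length_belowD.
- exact/length_belowT/ltnW.
Qed.

Lemma length_below_mull n s h : S s ->
  length_below n h -> length_below n.+1 (T s * h).
Proof.
move=> Ss; elim=> [|x y _ ? _ ?|d w lw].
- by rewrite mulr0; exact: length_below0.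
- by rewrite mulrDr; apply: length_belowD.
rewrite -scalerAr; apply: length_belowZ.
case: (length_mull hW w Ss) => lsw.
  by rewrite hecke_mull_up// -[T _]scale1r; apply: length_belowT; rewrite lsw.
rewrite hecke_mull_down//; apply: length_belowD; apply: length_belowT.
  exact: ltnW.
by rewrite ltnW// ltnW// -lsw.
Qed.

Lemma length_below_coef n h (f : W -> {additive H -> R}) y :
  (forall y c h, f y (c *: h) = c * f y h) ->
  (forall y w, f y (T w) = (w == y)%:R) ->
  length_below n h -> (n <= l y)%N -> f y h = 0.
Proof.
move=> fZ fT + ny; elim=> [|x z _ fx _ fz|d w lw]; first by rewrite raddf0.
  by rewrite raddfD fx fz addr0.
rewrite fZ fT; case: eqP => [wy|_]; last by rewrite mulr0.
by move: lw; rewrite wy ltnNge ny.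
Qed.

End Hecke.

(** * Triangularity of the bar involution and uniqueness modulo [k] *)

Section HeckeBar.
Variables (W : groupType) (S : set W).
Hypothesis hW : coxeter_system S.
Variables (R : comUnitRingType) (v : R) (H : unitAlgType R) (T : W -> H).
Hypothesis (hR : is_laurent_ring v) (hT : is_hecke_algebra S (v ^+ 2) T).
Variable bar : {rmorphism H -> H}.
Hypothesis hbar : is_hecke_bar v T bar.
Local Notation l := (cox_length S).

Lemma hecke_q_unit : v ^+ 2 \is a GRing.unit.
Proof. by rewrite unitrX ?(laurent_unit hR). Qed.
Local Notation qU := hecke_q_unit.

Lemma bar_exp (n : int) h : bar (v ^ n *: h) = v ^ (- n) *: bar h.
Proof.
have := hecke_barE hbar n 1%g; rewrite invg1 (hecke_one hT) invr1 => e.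
by rewrite -[h in LHS]mul1r scalerAl rmorphM e -scalerAl mul1r.
Qed.

(** The conjugation [v -> v^-1] of [R] is not built as a map; a conjugate coefficient independent of
    [h] is enough. *)
Lemma bar_semilinear c : exists c', forall h, bar (c *: h) = c' *: bar h.
Proof.
elim/(laurent_ind hR): c => [x y [x' xE] [y' yE]|n k].
  by exists (x' + y') => h; rewrite !scalerDl rmorphD xE yE.
exists (v ^ (- n) *~ k) => h.
by rewrite -!scalerMzl rmorphMz bar_exp.
Qed.

Lemma bar_q h : bar (v ^+ 2 *: h) = v ^- 2 *: bar h.
Proof. by rewrite exprnP bar_exp exprnN. Qed.

Lemma bar_horner (p : {poly int}) h :
  bar ((map_poly intr p).[v ^+ 2] *: h) =
  (\sum_(i < size p) v ^ (- (i.*2)%:Z) *~ p`_i) *: bar h.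
Proof.
rewrite horner_intr_sum !scaler_suml rmorph_sum /=; apply: eq_bigr => i _.
by rewrite -!scalerMzl rmorphMz -exprM mul2n exprnP bar_exp.
Qed.

Lemma bar_T w : bar (T w) = (T w^-1%g)^-1.
Proof. by have := hecke_barE hbar 0 w; rewrite oppr0 expr0z !scale1r. Qed.

Lemma bar_T_simple s : S s -> bar (T s) = (T s)^-1.
Proof. by move=> Ss; rewrite bar_T (simple_inv hW Ss). Qed.

(** Each factor [(T s)^-1 = q^-1 T s + (q^-1 - 1)], with [q = v ^+ 2], contributes [q^-1] to the
    leading coefficient and otherwise only terms of smaller length. *)
Lemma bar_T_triangular w :
  length_below S T (l w) (bar (T w) - v ^ (- ((l w).*2)%:Z) *: T w).
Proof.
elim/(length_ind hW): w => [|s w Ss IH lw].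
  rewrite (length1 hW) (hecke_one hT) rmorph1 oppr0 expr0z scale1r subrr.
  exact: length_below0.
set x := bar (T w) - _ in IH.
have bw : bar (T w) = v ^ (- ((l w).*2)%:Z) *: T w + x by rewrite addrC subrK.
rewrite -(hecke_mull_up hW hT Ss lw) rmorphM /= bar_T_simple// bw.
rewrite (hecke_simple_inv hT qU Ss).2 mulrDl -!scalerAl mul1r.
set z := (_ - 1) *: _; rewrite mulrDr -scalerAr scalerDr scalerA lw.
have -> : v ^- 2 * v ^ (- ((l w).*2)%:Z) = v ^ (- ((l w).+1.*2)%:Z).
  by rewrite exprnN -exprzDr ?(laurent_unit hR)// -opprD -PoszD doubleS.
rewrite -[_ + _ + z]addrA [_ + (_ + z)]addrC addrK; apply: length_belowD.
  by apply: length_belowZ; apply: (length_below_mull hW hT).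
apply: length_belowZ; apply: length_belowD; last exact: length_belowS.
exact: length_belowT.
Qed.

Lemma bar_T_coef (f : W -> {additive H -> R}) y w :
  (forall y c h, f y (c *: h) = c * f y h) ->
  (forall y w, f y (T w) = (w == y)%:R) -> (l w <= l y)%N ->
  f y (bar (T w)) = if w == y then v ^ (- ((l w).*2)%:Z) else 0.
Proof.
move=> fZ fT wy; have := length_below_coef fZ fT (bar_T_triangular w) wy.
move=> /eqP; rewrite raddfB subr_eq0 fZ fT => /eqP ->.
by case: eqP => _; rewrite ?mulr1 ?mulr0.
Qed.

(** Here [i + j <= 2 (sz - 1) < n - d]. With [d = l y], this separates the exponents of [E y] from
    those of its shifted conjugate. *)
Lemma shifted_exponent_neq (n d sz i j : nat) :
  (sz.-1.*2 + d < n)%N -> (i < sz)%N -> (j < sz)%N ->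
  ((n + n)%:Z - (d.*2)%:Z - (i.*2)%:Z = (j.*2)%:Z :> int) -> False.
Proof. by lia. Qed.

(** Used with [X = v^n], to clear the factor [v^-n] in front of [E y]. *)
Lemma shift_congruence (X X' L e p b c k : R) : X * X' = 1 ->
  X * (e * L) + b * k - X' * p = c * k ->
  X * X * L * e - p = X * (c - b) * k.
Proof.
move=> XX' h; have -> : X * X * L * e - p =
  X * (X * (e * L) + b * k - X' * p) - X * b * k + (X * X' - 1) * p by ring.
by rewrite h XX'; ring.
Qed.

(* Descending induction on [l y]: if E is divisible by k above y, then modulo k
   the coefficient of T_y in [bar D - D] only involves [E y], where it is a
   difference of two Laurent polynomials with disjoint supports. *)
Lemma KL_uniqueness (k n : nat) (Y : seq W) (E : W -> {poly int})
    (f : W -> {additive H -> R}) :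
  (forall y c h, f y (c *: h) = c * f y h) ->
  (forall y w, f y (T w) = (w == y)%:R) ->
  let D := v ^ (- n%:Z) *:
    \sum_(y <- Y) (map_poly intr (E y)).[v ^+ 2] *: T y in
  uniq Y ->
  (forall y, y \in Y -> E y != 0 -> ((size (E y)).-1.*2 + l y < n)%N) ->
  (forall y, y \in Y -> exists b, f y (bar D - D) = b *+ k) ->
  forall y, y \in Y -> exists Q, E y = Q *+ k.
Proof.
move=> fZ fT D uY degE Dk.
have vU := laurent_unit hR.
have [g gE] := laurent_coef hR.
move=> y; move: {2}(n - l y).+1 (ltnSn (n - l y)) => m.
elim: m y => // m IH y; rewrite ltnS => nym yY.
have [->|Ey0] := eqVneq (E y) 0; first by exists 0; rewrite mul0rn.
have deg := degE y yY Ey0.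
have lyn : (l y < n)%N by apply: leq_ltn_trans deg; rewrite leq_addl.
have {}IH x : x \in Y -> (l y < l x)%N -> exists Q, E x = Q *+ k.
  by move=> xY lx; apply: IH => //; apply: (leq_trans _ nym); apply: ltn_sub2l.
(* The conjugate of the value of [E x] at [v ^+ 2]. *)
pose e x := \sum_(i < size (E x)) v ^ (- (i.*2)%:Z) *~ (E x)`_i : R.
have barD : bar D = v ^ n%:Z *: \sum_(x <- Y) e x *: bar (T x).
  rewrite bar_exp opprK rmorph_sum /=; congr (_ *: _).
  by apply: eq_bigr => x _; rewrite bar_horner.
have fsum (c : W -> R) (h : W -> H) :
    f y (\sum_(x <- Y) c x *: h x) = \sum_(x <- Y) c x * f y (h x).
  by rewrite raddf_sum; apply: eq_bigr => x _; rewrite fZ.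
have fD : f y D = v ^ (- n%:Z) * (map_poly intr (E y)).[v ^+ 2].
  rewrite fZ fsum (bigD1_seq y)//= fT eqxx mulr1 big1 ?addr0// => x xy.
  by rewrite fT (negbTE xy) mulr0.
have [b fbD] : exists b, f y (bar D) =
    v ^ n%:Z * (e y * v ^ (- ((l y).*2)%:Z)) + b *+ k.
  rewrite barD fZ fsum (bigD1_seq y)//= bar_T_coef// eqxx mulrDr.
  (* A term with [l x <= l y] vanishes by triangularity; one with [l x > l y] is divisible by [k] by
     induction. *)
  have [b ->] : exists b,
      \sum_(x <- Y | x != y) e x * f y (bar (T x)) = b *+ k; last first.
    by exists (v ^ n%:Z * b); rewrite mulrnAr.
  rewrite big_seq_cond.
  apply: (big_ind (fun s => exists b, s = b *+ k)) => [|_ _ [a ->] [b ->]|x].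
  - by exists 0; rewrite mul0rn.
  - by exists (a + b); rewrite mulrnDl.
  move=> /andP[xY xy]; have [lx|lx] := leqP (l x) (l y).
    by exists 0; rewrite bar_T_coef// (negbTE xy) mulr0 mul0rn.
  have [Q EQ] := IH x xY lx.
  exists ((\sum_(i < size (E x)) v ^ (- (i.*2)%:Z) *~ Q`_i) * f y (bar (T x))).
  rewrite -mulrnAl -sumrMnl; congr (_ * _); apply: eq_bigr => i _.
  have -> : (E x)`_i = Q`_i *+ k by rewrite -coefMn -EQ.
  by rewrite -[Q`_i *+ k]mulr_natr natz mulrzA -pmulrn.
have [c] := Dk y yY; rewrite raddfB fbD fD => bc.
have vv : v ^ n%:Z * v ^ (- n%:Z) = 1 by rewrite -exprzDr// subrr expr0z.
have {}bc : v ^ n%:Z * v ^ n%:Z * v ^ (- ((l y).*2)%:Z) * e y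
    - (map_poly intr (E y)).[v ^+ 2] = (v ^ n%:Z * (c - b)) *+ k.
  rewrite -[RHS]mulr_natr; apply: (shift_congruence vv).
  by rewrite !mulr_natr.
have eE j : g (j.*2)%:Z (v ^ n%:Z * v ^ n%:Z * v ^ (- ((l y).*2)%:Z) * e y) =
    \sum_(i < size (E y)) (if (n + n)%:Z - ((l y).*2)%:Z - (i.*2)%:Z == (j.*2)%:Z
      then (E y)`_i else 0).
  rewrite mulr_sumr raddf_sum; apply: eq_bigr => i _.
  by rewrite mulrzAr -!exprzDr// gE.
have pE j : g (j.*2)%:Z (map_poly intr (E y)).[v ^+ 2] =
    \sum_(i < size (E y)) (if (i.*2)%:Z == (j.*2)%:Z then (E y)`_i else 0).
  rewrite horner_intr_sum raddf_sum; apply: eq_bigr => i _.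
  by rewrite -exprM mul2n exprnP gE.
apply: poly_divn => j; have [ltj|lej] := ltnP j (size (E y)); last first.
  by exists 0; rewrite nth_default// mul0rn.
(* At exponent [2j] the shifted conjugate contributes nothing, so only the coefficient of [E y]
   survives, with a minus sign. *)
exists (- g (j.*2)%:Z (v ^ n%:Z * (c - b))).
rewrite mulNrn -raddfMn -bc raddfB opprB eE pE (bigD1 (Ordinal ltj))//= eqxx.
rewrite !big1 ?addr0 ?subr0// => i.
  by move=> _; case: eqP => // /(shifted_exponent_neq deg (ltn_ord i) ltj).
by rewrite -val_eqE /= => /eqP ?; case: eqP => // -[?]; lia.
Qed.

End HeckeBar.

(** * Tate cohomology modulo 2 *)

Section Twist.
Variables (W : groupType) (S : set W).
Hypothesis hW : coxeter_system S.
Variable star : {multiplicative W -> W}.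
Hypotheses (starK : involutive star) (starS : forall s, S s -> S (star s)).
Local Notation l := (cox_length S).

(** An anti-automorphism of [W], whose fixed points are the twisted involutions. *)
Definition twist (w : W) : W := ((star w)^-1)%g.

Lemma star1 : star 1%g = 1%g.
Proof. by apply: (mulgI (star 1%g)); rewrite -gmulfM !mulg1. Qed.

Lemma starV w : star (w^-1)%g = ((star w)^-1)%g.
Proof. by apply: (mulgI (star w)); rewrite -gmulfM !mulgV star1. Qed.

Lemma twistK : involutive twist.
Proof. by move=> w; rewrite /twist starV starK invgK. Qed.

Lemma twistM x y : twist (x * y)%g = (twist y * twist x)%g.
Proof. by rewrite /twist gmulfM invgM. Qed.

Lemma twistV x : twist (x^-1)%g = ((twist x)^-1)%g.
Proof. by rewrite /twist starV. Qed.

Lemma twist1 : twist 1%g = 1%g.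
Proof. by rewrite /twist star1 invg1. Qed.

Lemma twist_simple s : S s -> twist s = star s.
Proof. by move=> Ss; rewrite /twist (simple_inv hW)//; apply: starS. Qed.

Lemma length_twist w : l (twist w) = l w.
Proof.
suff le x : (l (star x) <= l x)%N.
  rewrite /twist (length_inv hW); apply/eqP; rewrite eqn_leq le /=.
  by have := le (star w); rewrite starK.
elim/(length_ind hW): x => [|s x Ss IH ->]; first by rewrite star1.
rewrite gmulfM (leq_trans (length_mul hW _ _))// (length_simple hW)//.
exact: starS.
Qed.

(** [twist] moves the reflection of an elementary step to the left; conjugation by [twist y] brings
    it back to the right. *)
Lemma bruhat_twist x w : bruhat S x w -> bruhat S (twist x) (twist w).
Proof.
elim=> [y z [t [tref -> lt]]|y|y z u _ h1 _ h2]; last exact: rt_trans h1 h2.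
  apply: rt_step; exists (twist y^-1 * twist t * twist y)%g.
  rewrite !length_twist; split=> //.
    have [s [a [Ss ->]]] := tref.
    exists (star s), (twist y^-1 * twist a^-1)%g; split; first exact: starS.
    by rewrite !twistM !twistV !invgM !invgK (twist_simple Ss) !mulgA.
  by rewrite twistM twistV !mulgA mulgV mul1g.
exact: rt_refl.
Qed.

Section Twist_Hecke.
Variables (R : comUnitRingType) (v : R) (H : unitAlgType R) (T : W -> H).
Hypothesis (hR : is_laurent_ring v) (hT : is_hecke_algebra S (v ^+ 2) T).
Variable bar : {rmorphism H -> H}.
Hypothesis hbar : is_hecke_bar v T bar.
Let qU := hecke_q_unit hR.

Lemma hecke_twist : exists tau : {additive H -> H},
  forall c w, tau (c *: T w) = c *: T (twist w).
Proof.
have [|g gE] := hecke_ext (F := fun w c => c *: T (twist w)) hT.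
  by move=> w c d; rewrite scalerDl.
by exists g.
Qed.

Variable tau : {additive H -> H}.
Hypothesis tauE : forall c w, tau (c *: T w) = c *: T (twist w).

Lemma tauZ c h : tau (c *: h) = c *: tau h.
Proof.
elim/(hecke_ind hT): h => [|x y hx hy|d w].
- by rewrite scaler0 raddf0 scaler0.
- by rewrite scalerDr !raddfD hx hy ?scalerDr.
- by rewrite scalerA !tauE scalerA.
Qed.

Lemma tau_T w : tau (T w) = T (twist w).
Proof. by rewrite -[T w]scale1r tauE scale1r. Qed.

Lemma tau1 : tau 1 = 1.
Proof. by rewrite -(hecke_one hT) tau_T twist1. Qed.

Lemma tauK : involutive tau.
Proof.
move=> h; elim/(hecke_ind hT): h => [|x y hx hy|d w].
- by rewrite !raddf0.
- by rewrite !raddfD hx hy.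
- by rewrite !tauE twistK.
Qed.

(** [twist] preserves length and exchanges sides, so it carries the left multiplication formulas for
    [s] to the right ones for [star s]. *)
Lemma tau_simple_mul s h : S s -> tau (T s * h) = tau h * T (star s).
Proof.
move=> Ss; have Sss := starS Ss.
elim/(hecke_ind hT): h => [|x y hx hy|d w].
- by rewrite mulr0 raddf0 mul0r.
- by rewrite mulrDr !raddfD hx hy mulrDl.
rewrite -scalerAr !tauZ !tau_T -scalerAl; congr (_ *: _).
have tsw : twist (s * w)%g = (twist w * star s)%g.
  by rewrite twistM (twist_simple Ss).
case: (length_mull hW w Ss) => lsw.
  rewrite (hecke_mull_up hW hT)// (hecke_mulr_up hW hT)//.
    by rewrite tau_T tsw.
  by rewrite -tsw !length_twist.
rewrite (hecke_mull_down hW hT)// (hecke_mulr_down hW hT)//.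
  by rewrite raddfD /= !tauE tsw.
by rewrite -tsw !length_twist.
Qed.

Lemma tauM g h : tau (g * h) = tau h * tau g.
Proof.
elim/(hecke_ind hT): g => [|x y hx hy|d w].
- by rewrite mul0r raddf0 mulr0.
- by rewrite mulrDl !raddfD hx hy mulrDr.
rewrite -scalerAl !tauZ -scalerAr; congr (_ *: _).
elim/(length_ind hW): w h => [h|s w Ss IH lsw h].
  by rewrite (hecke_one hT) mul1r tau1 mulr1.
rewrite -(hecke_mull_up hW hT)// -mulrA !(tau_simple_mul _ Ss) IH tau_T.
by rewrite mulrA.
Qed.

Lemma tauV x : x \is a GRing.unit -> tau x^-1 = (tau x)^-1.
Proof.
move=> xU; have e1 : tau x * tau x^-1 = 1 by rewrite -tauM mulVr// tau1.
have e2 : tau x^-1 * tau x = 1 by rewrite -tauM mulrV// tau1.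
have U : tau x \is a GRing.unit by apply/unitrP; exists (tau x^-1).
by apply: (mulIr U); rewrite mulVr.
Qed.

Lemma tau_bar h : tau (bar h) = bar (tau h).
Proof.
elim/(hecke_ind hT): h => [|x y hx hy|c w].
- by rewrite !(raddf0, rmorph0).
- by rewrite !(raddfD, rmorphD) hx hy.
have [c' cE] := bar_semilinear hR hT hbar c.
rewrite tauE !cE tauZ !(bar_T hbar) tauV ?(hecke_unit hW hT qU)//.
by rewrite tau_T twistV.
Qed.

(* Elements that vanish in the Tate cohomology of tau acting on the reduction
   of the Hecke algebra modulo 2, up to (1+q)-torsion: when sw = w star(s) > w,
   T_s a_w only gives (u+1) a_{sw}, so that u+1 has to be cancelled. *)
Definition tate_null (h : H) : Prop := exists k g g',
  (1 + v ^+ 2) ^+ k *: h = g + tau g + g' *+ 2.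

Lemma tate_null_norm g : tate_null (g + tau g).
Proof. by exists 0%N, g, 0; rewrite expr0 scale1r mul0rn addr0. Qed.

Lemma tate_null_double g : tate_null (g *+ 2).
Proof. by exists 0%N, 0, g; rewrite expr0 scale1r raddf0 !add0r. Qed.

Lemma tate_null0 : tate_null 0.
Proof. by have := tate_null_double 0; rewrite mul0rn. Qed.

Lemma tate_nullZ c h : tate_null h -> tate_null (c *: h).
Proof.
move=> [k [g [g' e]]]; exists k, (c *: g), (c *: g').
by rewrite scalerA mulrC -scalerA e tauZ !scalerDr.
Qed.

Lemma tate_nullD x y : tate_null x -> tate_null y -> tate_null (x + y).
Proof.
move=> [k [g [g' e]]] [k' [f [f' e']]]; set c := 1 + v ^+ 2.
exists (k + k')%N, (c ^+ k' *: g + c ^+ k *: f), (c ^+ k' *: g' + c ^+ k *: f').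
rewrite scalerDr {1}addnC !exprD -!scalerA e e' (raddfD tau) !tauZ !scalerDr.
by rewrite mulr2n [LHS]addrACA; congr (_ + _); exact: addrACA.
Qed.

Lemma tate_nullN x : tate_null x -> tate_null (- x).
Proof. by rewrite -scaleN1r; exact: tate_nullZ. Qed.

Lemma tate_nullB x y : tate_null x -> tate_null y -> tate_null (x - y).
Proof. by move=> hx /tate_nullN; exact: tate_nullD. Qed.

Lemma tate_null_sym x y : tate_null (x - y) -> tate_null (y - x).
Proof. by move=> /tate_nullN; rewrite opprB. Qed.

Lemma tate_null_trans y x z :
  tate_null (x - y) -> tate_null (y - z) -> tate_null (x - z).
Proof. by move=> h1 h2; have := tate_nullD h1 h2; rewrite addrA subrK. Qed.

Lemma tate_null_torsion h : tate_null ((1 + v ^+ 2) *: h) -> tate_null h.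
Proof.
by move=> [k [g [g' e]]]; exists k.+1, g, g'; rewrite exprSr -scalerA.
Qed.

(** Since [tau] is an anti-involution, [x * tau g * tau x] is the image under [tau] of
    [x * g * tau x]: norms go to norms. *)
Lemma tate_null_conj x h : tate_null h -> tate_null (x * h * tau x).
Proof.
move=> [k [g [g' e]]]; exists k, (x * g * tau x), (x * g' * tau x).
by rewrite scalerAl scalerAr e !tauM tauK !mulrDr !mulrDl mulrA.
Qed.

Lemma tate_null_conj_unit x h : x \is a GRing.unit ->
  tate_null (x * h * tau x) -> tate_null h.
Proof.
move=> xU /(tate_null_conj x^-1); rewrite tauV// -!mulrA.
have tU : tau x \is a GRing.unit.
  by apply/unitrP; exists (tau x^-1); rewrite -!tauM mulVr// mulrV// tau1.
by rewrite mulrV// mulr1 mulKr.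
Qed.

Lemma tate_null_bar h : tate_null h -> tate_null (bar h).
Proof.
(* The conjugate of [1 + q] is [q^-1 (1 + q)], so a factor [q ^+ k] restores the power of
   [1 + q]. *)
move=> [k [g [g' e]]]; exists k, (v ^+ 2 ^+ k *: bar g), (v ^+ 2 ^+ k *: bar g').
have bc x : bar ((1 + v ^+ 2) *: x) = v ^- 2 *: ((1 + v ^+ 2) *: bar x).
  rewrite scalerDl scale1r rmorphD /= (bar_q hT hbar) scalerA mulrDr mulr1.
  by rewrite mulVr// scalerDl scale1r addrC.
have {bc}bck x : v ^+ 2 ^+ k *: bar ((1 + v ^+ 2) ^+ k *: x) =
    (1 + v ^+ 2) ^+ k *: bar x.
  elim: k x {e} => [|k IH] x; first by rewrite !expr0 !scale1r.
  rewrite (exprSr (v ^+ 2)) (exprS (1 + v ^+ 2)).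
  rewrite -[(_ * v ^+ 2) *: _]scalerA -[((1 + v ^+ 2) * _) *: x]scalerA.
  rewrite -[((1 + v ^+ 2) * _) *: bar x]scalerA bc.
  rewrite (scalerA (v ^+ 2) (v ^- 2)) mulrV// scale1r.
  by rewrite scalerA mulrC -scalerA IH.
by rewrite -bck e !rmorphD /= !scalerDr tauZ tau_bar.
Qed.

(** At a fixed point of [twist], [g] and [tau g] have equal coefficients, so a norm contributes an
    even one; the power of [1 + q] is cancelled modulo 2. *)
Lemma tate_null_coef (f : W -> {additive H -> R}) h y :
  (forall y c h, f y (c *: h) = c * f y h) ->
  (forall y w, f y (T w) = (w == y)%:R) ->
  twist y = y -> tate_null h -> exists b, f y h = b *+ 2.
Proof.
move=> fZ fT ty [k [g [g' e]]].
have ftau x : f y (tau x) = f y x.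
  elim/(hecke_ind hT): x => [|x z hx hz|c w].
  - by rewrite !raddf0.
  - by rewrite !raddfD hx hz.
  by rewrite tauE !fZ !fT -{1}ty (can_eq twistK).
have {e} : (1 + v ^+ 2) ^+ k * f y h = (f y g + f y g') *+ 2.
  by rewrite -fZ e !raddfD /= ftau mulr2n; exact: addrACA.
elim: k (f y h) (f y g + f y g') => [|k IH] a b.
  by rewrite expr0 mul1r => ->; exists b.
by rewrite exprSr -mulrA => /IH[c /(laurent_even_factor hR)].
Qed.

(* An orbit {y, twist y} with two elements contributes a norm; the element
   selected in it is the value of [choose], which only depends on the orbit. *)
Lemma tate_null_noninvolutions (Y : seq W) (c : W -> R) :
  uniq Y -> (forall y, y \in Y -> twist y \in Y) ->
  (forall y, y \in Y -> exists b, c (twist y) = c y + b *+ 2) ->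
  tate_null (\sum_(y <- Y | twist y != y) c y *: T y).
Proof.
move=> uY tY cY.
pose rep y := choose (fun z => (z == y) || (z == twist y)) y.
have rep_tw y : rep (twist y) = rep y.
  rewrite /rep twistK.
  rewrite (@eq_choose _ _ (fun z => (z == y) || (z == twist y))).
    by apply: choose_id; rewrite eqxx ?orbT.
  by move=> z /=; rewrite orbC.
have repP y : (rep y == y) || (rep y == twist y).
  by apply: (@chooseP _ (fun z => (z == y) || (z == twist y))); rewrite eqxx.
pose b y := rep y == y.
have btw y : twist y != y -> b (twist y) = ~~ b y.
  move=> ty; rewrite /b rep_tw; have := repP y; case: eqP => [->|_] /=.
    by rewrite eq_sym (negbTE ty).
  by move=> ->.
have pY : perm_eq Y (map twist Y).
  apply: uniq_perm => //; first by rewrite map_inj_uniq//; exact: inv_inj twistK.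
  move=> y; apply/idP/mapP => [/tY yY|[x /tY xY ->//]].
  by exists (twist y) => //; rewrite twistK.
pose g := \sum_(y <- Y | (twist y != y) && b y) c y *: T y.
(* The chosen representatives give [g]. Replacing [c (twist y)] by [c y] on the other half gives
   [tau g], with an even correction. *)
have -> : \sum_(y <- Y | twist y != y) c y *: T y = (g + tau g) +
    \sum_(y <- Y | (twist y != y) && b y) (c (twist y) - c y) *: T (twist y).
  rewrite (bigID b) /= -/g -addrA; congr (_ + _).
  rewrite (perm_big _ pY) big_map /= raddf_sum /= -big_split /=.
  apply: eq_big => [y|y _]; last by rewrite tauE scalerBl addrC subrK.
  by rewrite twistK eq_sym; case: eqP => //= /eqP /btw ->; rewrite negbK.
apply: tate_nullD; first exact: tate_null_norm.
rewrite big_seq_cond; apply: (big_ind tate_null).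
- exact: tate_null0.
- by move=> x y; exact: tate_nullD.
move=> y /andP[/cY[d ->] _]; rewrite addrC addKr -scalerMnl.
exact: tate_null_double.
Qed.

End Twist_Hecke.
End Twist.

(** * Comparison with the module of twisted involutions *)

Section InvolutionModule.
Variables (W : groupType) (S : set W).
Hypothesis hW : coxeter_system S.
Variable star : {multiplicative W -> W}.
Hypotheses (starK : involutive star) (starS : forall s, S s -> S (star s)).
Variables (A : comUnitRingType) (u : A).
Hypothesis hA : is_laurent_ring u.
Variables (H : unitAlgType A) (T : W -> H).
Hypothesis hH : is_hecke_algebra S (u ^+ 2) T.
Variable barH : {rmorphism H -> H}.
Hypothesis hbarH : is_hecke_bar u T barH.
Variables (M : lmodType H) (a : W -> M).
Hypothesis hM : is_involution_module S star u T a.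
Variable barM : {additive M -> M}.
Hypothesis hbarM : is_involution_bar barH a barM.
Variables (Av : comUnitRingType) (v : Av).
Hypothesis hAv : is_laurent_ring v.
Variable phi : {rmorphism A -> Av}.
Hypothesis hphi : phi u = v ^+ 2.
Variables (Hv : unitAlgType Av) (t : W -> Hv).
Hypothesis hHv : is_hecke_algebra S (v ^+ 2) t.
Variable barHv : {rmorphism Hv -> Hv}.
Hypothesis hbarHv : is_hecke_bar v t barHv.
Variable tau : {additive Hv -> Hv}.
Hypothesis tauE : forall c w, tau (c *: t w) = c *: t (twist star w).
Local Notation l := (cox_length S).
Local Notation q := (v ^+ 2).
Local Notation tw := (twist star).
Local Notation I_ := (twisted_involutions star).
Local Notation null := (tate_null v tau).
Let qU := hecke_q_unit hAv.
Let nullZ := tate_nullZ hHv tauE.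
Let nullD := tate_nullD hHv tauE.
Let nullB := tate_nullB hHv tauE.
Let null_sym := tate_null_sym hHv tauE.
Let null_trans := tate_null_trans hHv tauE.

Lemma hecke_scaleA (c : A) (h : H) (m : M) : h *: (c%:A *: m) = c%:A *: (h *: m).
Proof. by rewrite !scalerA -scalerAr mulr1 -scalerAl mul1r. Qed.

(** The comparison [a w -> t w], semilinear along [phi]. It respects the Hecke actions and the bar
    operators only up to null elements. *)
Lemma involution_to_hecke : exists pi : {additive M -> Hv},
  forall c w, I_ w -> pi (c%:A *: a w) = phi c *: t w.
Proof.
have [| |g gE] := basis_ext (F := fun w c => phi c *: t w) (inv_basis hM).
- by move=> x c d; rewrite !scalerDl.
- by move=> w c d; rewrite rmorphD scalerDl.
by exists g => c w; exact: gE.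
Qed.

Variable pi : {additive M -> Hv}.
Hypothesis piE : forall c w, I_ w -> pi (c%:A *: a w) = phi c *: t w.

Lemma piZ c m : pi (c%:A *: m) = phi c *: pi m.
Proof.
elim/(basis_ind (inv_basis hM)): m => [|x y hx hy|w d Iw].
- by rewrite scaler0 !raddf0 ?scaler0.
- by rewrite scalerDr !(raddfD pi) hx hy scalerDr.
by rewrite scalerA -scalerAl mul1r scalerA !piE// rmorphM scalerA.
Qed.

Lemma pi_a w : I_ w -> pi (a w) = t w.
Proof. by move=> Iw; have := piE 1 Iw; rewrite rmorph1 !scale1r. Qed.

Lemma twist_mull_simple s w : S s -> I_ w -> tw (s * w)%g = (w * star s)%g.
Proof.
by move=> Ss Iw; rewrite twistM (twist_simple hW starS Ss) (Iw : tw w = w).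
Qed.

Lemma length_mulr_star s w : S s -> I_ w -> l (w * star s)%g = l (s * w)%g.
Proof.
by move=> Ss Iw; rewrite -(twist_mull_simple Ss Iw) (length_twist hW starK starS).
Qed.

Lemma involution_mull s w : S s -> I_ w ->
  (s * w)%g = (w * star s)%g -> I_ (s * w)%g.
Proof.
by move=> Ss Iw sw; change (tw (s * w)%g = (s * w)%g); rewrite twist_mull_simple.
Qed.

Lemma involution_conj s w : S s -> I_ w -> I_ (s * w * star s)%g.
Proof.
move=> Ss Iw; change (tw (s * w * star s)%g = (s * w * star s)%g).
rewrite twistM twist_mull_simple// mulgA.
by rewrite -(twist_simple hW starS Ss) twistK.
Qed.

(* On Tate cohomology modulo 2 the element T_s, whose parameter is q^2, acts as
   h |-> t_s h tau(t_s); on the basis this reproduces the formulas defining M. *)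
Lemma pi_simple s m : S s -> null (pi (T s *: m) - t s * pi m * tau (t s)).
Proof.
move=> Ss; have Sss := starS Ss.
rewrite (tau_T tauE) (twist_simple hW starS Ss).
elim/(basis_ind (inv_basis hM)): m => [|x y hx hy|w c Iw].
- by rewrite scaler0 raddf0 mulr0 mul0r subrr; exact: tate_null0.
- rewrite scalerDr !(raddfD pi) mulrDr mulrDl opprD addrACA.
  exact: nullD.
rewrite hecke_scaleA !piZ pi_a// -scalerAr -scalerAl -scalerBr.
apply: nullZ.
have lws := length_mulr_star Ss Iw.
have wK : (w * star s * star s)%g = w by rewrite (simpleKr hW).
case: (length_mull hW w Ss) => lsw.
  have sw_lt := bruhat_lt_mull Ss lsw.
  have [sw|/eqP sw] := eqVneq (s * w)%g (w * star s)%g.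
    rewrite (inv_comm_up hM Ss Iw sw sw_lt) raddfD !piZ !pi_a//; last first.
      exact: involution_mull.
    rewrite (hecke_mull_up hW hHv)// {2}sw (hecke_mulr_down hW hHv) ?wK//; last first.
      by rewrite lws.
    rewrite -sw rmorphD rmorph1 hphi [q *: t w + _]addrC.
    rewrite [(q - 1) *: _ + _]addrC addrKA -scalerBl.
    (* Only the coefficients of [t (s * w)] differ: [q + 1] in [M], [q - 1] in the Hecke algebra. *)
    have -> : q + 1 - (q - 1) = 1 *+ 2 by ring.
    by rewrite -scalerMnl; exact: tate_null_double.
  rewrite (inv_noncomm_up hM Ss Iw sw sw_lt) pi_a; last exact: involution_conj.
  rewrite (hecke_mull_up hW hHv)// (hecke_mulr_up hW hHv)// ?subrr.
    exact: tate_null0.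
  by rewrite (length_mull_mulr_up hW)// ?lws// lsw.
have sw_lt : bruhat_lt S (s * w)%g w.
  by have := @bruhat_lt_mull _ S (s * w)%g s Ss; rewrite (simpleK hW)//; apply.
have [sw|/eqP sw] := eqVneq (s * w)%g (w * star s)%g.
  rewrite (inv_comm_down hM Ss Iw sw sw_lt) raddfD !piZ !pi_a//; last first.
    exact: involution_mull.
  rewrite (hecke_mull_down hW hHv)// mulrDl -!scalerAl.
  rewrite (hecke_mulr_down hW hHv) ?lws// -sw (hecke_mulr_up hW hHv)//; last first.
    by rewrite {1}sw wK lsw.
  rewrite sw wK -sw !rmorphB rmorphXn /= rmorph1 hphi.
  rewrite scalerDr !scalerA [_ + _ + q *: t w]addrAC -scalerDl.
  have -> : (q - 1) * q = q ^+ 2 - q by ring.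
  rewrite [(_ * _ + q) *: _ + _]addrC addrKA -scalerBl.
  have -> : q ^+ 2 - q - 1 - ((q - 1) * (q - 1) + q) = (- 1) *+ 2 by ring.
  by rewrite -scalerMnl; exact: tate_null_double.
rewrite (inv_noncomm_down hM Ss Iw sw sw_lt) raddfD !piZ !pi_a//; last first.
  exact: involution_conj.
rewrite (hecke_mull_down hW hHv)// mulrDl -!scalerAl.
rewrite (hecke_mulr_down hW hHv) ?lws// (hecke_mulr_down hW hHv)//; last first.
  have := length_mull_mulr_down hW Ss Sss lsw.
  by rewrite lws => /(_ lsw sw); rewrite lsw => -[].
rewrite !rmorphB !rmorphXn /= rmorph1 hphi !scalerDr !scalerA.
(* The two mixed terms have the same coefficient [q (q - 1)] and are exchanged by [tau], hence form
   a norm. *)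
set x := t (w * star s)%g; set y := t (s * w)%g.
have xy : x = tau y by rewrite (tau_T tauE) twist_mull_simple.
have abel (A1 A2 X Y Z : Hv) :
    A1 + Z - (A2 + X + (Y + Z)) = (A1 - A2) - (Y + X).
  rewrite [A2 + X + _]addrA [A2 + X + Y + Z]addrC addrKA -addrA opprD addrA.
  by rewrite [X + Y]addrC.
rewrite -[q * q]expr2 [(q - 1) * q]mulrC abel -scalerBl -scalerDr xy.
have -> : q ^+ 2 - 1 - (q - 1) * (q - 1) = (q - 1) *+ 2 by ring.
rewrite -scalerMnl.
apply: nullB; first exact: tate_null_double.
by apply: nullZ; exact: tate_null_norm.
Qed.

(** One conjugate scalar serves both algebras, because [phi] sends [u ^ n] to [v ^ (2 * n)]. *)
Lemma bar_scalars c : exists c',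
  barH c%:A = c'%:A /\ forall h, barHv (phi c *: h) = phi c' *: barHv h.
Proof.
elim/(laurent_ind hA): c => [x y [x' [xE xE']] [y' [yE yE']]|n k].
  exists (x' + y'); rewrite !scalerDl !rmorphD xE yE; split=> // h.
  by rewrite !scalerDl rmorphD xE' yE'.
exists (u ^ (- n) *~ k).
have uU := laurent_unit hA; have vU := laurent_unit hAv.
split=> [|h]; first by rewrite -!scalerMzl rmorphMz (bar_exp hH hbarH) rmorph1.
have phiX m : phi (u ^ m) = v ^ (2 * m) by rewrite rmorphXz// hphi exprnP exprz_exp.
rewrite !rmorphMz !phiX -!scalerMzl rmorphMz (bar_exp hHv hbarHv).
by rewrite mulrN.
Qed.

Lemma descent w : w <> 1%g -> exists2 s, S s & l w = (l (s * w)%g).+1.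
Proof.
elim/(length_ind hW): w => [//|s w Ss _ lw _].
by exists s => //; rewrite (simpleK hW).
Qed.

(** Induction on length through a left descent [s]. If [s w] differs from [w star(s)], then [a w] is
    [T s] applied to a shorter basis element; otherwise only [(u + 1) a w] is reached from
    [a (s * w)]. *)
Lemma pi_bar_a w : I_ w -> null (pi (barM (a w)) - barHv (t w)).
Proof.
have vU := laurent_unit hAv.
move: {2}(l w).+1 (ltnSn (l w)) => n; elim: n w => // n IH w lwn Iw.
have [->|/eqP/descent[s Ss lsw]] := eqVneq w 1%g.
  have I1 : I_ 1%g by change (tw 1%g = 1%g); rewrite twist1.
  rewrite (inv_bar1 hbarM) pi_a// (hecke_one hHv) rmorph1 subrr.
  exact: tate_null0.
have Sss := starS Ss.
pose C x := t s * x * tau (t s).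
have tsU : t s \is a GRing.unit := hecke_unit hW hHv qU s.
have tauts : tau (t s) = t (star s).
  by rewrite (tau_T tauE) (twist_simple hW starS Ss).
have CB x y : C (x - y) = C x - C y by rewrite /C mulrBr mulrBl.
have CD x y : C (x + y) = C x + C y by rewrite /C mulrDr mulrDl.
have CZ c x : C (c *: x) = c *: C x by rewrite /C -scalerAr -scalerAl.
have Cbar x : C (barHv (C x)) = barHv x.
  rewrite /C !rmorphM /= tauts !(bar_T_simple hW hbarHv)//.
  by rewrite !mulrA mulrV// mul1r mulrVK// (hecke_unit hW hHv qU).
(* [C] is the action of [T s] on Tate cohomology. It is invertible, so the comparison may be made
   after applying it. *)
have Cnull m y : null (pi (T s *: m) - C y) -> null (pi m - y).
  move=> h; apply: (tate_null_conj_unit hW starK starS hHv tauE tsU).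
  rewrite -/(C _) CB; apply: (null_trans _ h).
  apply: null_sym; exact: pi_simple.
have lws := length_mulr_star Ss Iw.
have CNull x : null x -> null (C x).
  exact: (tate_null_conj hW starK starS hHv tauE).
have barTs m : T s *: barM (T s *: m) = barM m.
  rewrite (inv_barZ hbarM) (bar_T_simple hW hbarH)// scalerA.
  by rewrite mulrV ?scale1r// (hecke_unit hW hH (hecke_q_unit hA)).
have wK : (w * star s * star s)%g = w by rewrite (simpleKr hW).
apply: Cnull.
have [sw|/eqP sw] := eqVneq (s * w)%g (w * star s)%g; last first.
  set w' := (s * w * star s)%g.
  have Iw' : I_ w' by exact: involution_conj.
  have lw' : l w = (l w').+2.
    by apply: (length_mull_mulr_down hW Ss Sss) => //; rewrite lws.
  have sw' : (s * w')%g = (w * star s)%g by rewrite /w' -!mulgA (simpleK hW).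
  have w's : (w' * star s)%g = (s * w)%g by rewrite (simpleKr hW).
  have lsw' : l (s * w')%g = (l w').+1.
    by rewrite sw' lws; move: lw'; rewrite lsw => -[].
  have aw : T s *: a w' = a w.
    rewrite (inv_noncomm_up hM Ss Iw' _ (bruhat_lt_mull Ss lsw')) ?sw' ?wK//.
    by rewrite w's => /esym.
  have tW : t w = C (t w').
    rewrite /C tauts (hecke_mull_up hW hHv)// (hecke_mulr_up hW hHv)//.
      by rewrite sw' wK.
    by rewrite sw' wK lws.
  rewrite -aw barTs tW Cbar; apply: IH => //.
  by move: lwn; rewrite lw' ltnS; exact: ltnW.
set w' := (s * w)%g.
have Iw' : I_ w' by exact: involution_mull.
have sw' : (s * w')%g = w by rewrite (simpleK hW).
have w's : (w' * star s)%g = w by rewrite /w' sw.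
have {}IH : null (pi (barM (a w')) - barHv (t w')).
  by apply: IH => //; move: lwn; rewrite lsw ltnS.
have aw : T s *: a w' = u%:A *: a w' + (u + 1)%:A *: a w.
  rewrite -[in RHS]sw'; apply: (inv_comm_up hM Ss Iw'); first by rewrite sw' w's.
  by rewrite sw'; apply: (eq_ind _ _ (bruhat_lt_mull Ss _) _ sw'); rewrite sw'.
have uU := laurent_unit hA.
have barHu : barH u%:A = (u^-1)%:A.
  by have := bar_exp hH hbarH 1 1; rewrite expr1z exprN1 rmorph1.
have barHu1 : barH (u + 1)%:A = (u^-1 + 1)%:A.
  by rewrite !scalerDl rmorphD barHu scale1r rmorph1.
set b := q^-1.
have phib : phi u^-1 = b by rewrite rmorphV// hphi.
have e1 : pi (barM (a w')) =
    b *: pi (T s *: barM (a w')) + (b + 1) *: pi (T s *: barM (a w)).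
  rewrite -[in LHS]barTs aw raddfD /= !(inv_barZ hbarM) barHu barHu1 scalerDr.
  by rewrite !hecke_scaleA raddfD /= !piZ rmorphD rmorph1 phib.
have e2 : barHv (t w') = b *: C (barHv (t w')) + (b - 1) *: C (barHv (t w)).
  have Ctw : C (t w') = (q - 1) *: t w + q *: t w'.
    rewrite /C tauts (hecke_mull_up hW hHv) ?sw'// (hecke_mulr_down hW hHv).
    - by rewrite -sw.
    - by [].
    - by rewrite -sw.
  rewrite -[LHS]Cbar Ctw raddfD /= scalerBl scale1r raddfB /= !(bar_q hHv hbarHv).
  by rewrite addrC CD CB !CZ scalerBl scale1r.
(* The expansions [e1] and [e2] are subtracted; their coefficients [b + 1] and [b - 1] differ by 2,
   whence the last term. *)
have e : (b + 1) *: (pi (T s *: barM (a w)) - C (barHv (t w))) =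
    (pi (barM (a w')) - barHv (t w'))
    - b *: (pi (T s *: barM (a w')) - C (barHv (t w')))
    - C (barHv (t w)) *+ 2.
  have abel (p r y c z : Hv) :
      r - (y + c) = (p + r - (z + (y - c))) - (p - z) - c *+ 2.
    rewrite [p + r - _ - _]addrAC [p + r]addrC addrKA opprK addrKA.
    by rewrite -[RHS]addrA -opprD mulr2n addrA subrK.
  rewrite e1 {1}e2 scalerBr (scalerBl b) !(scalerDl _ b) !scale1r.
  rewrite (scalerBr b); exact: abel.
(* The factor [b + 1] is [1 + q] up to a unit; the torsion allowed in [tate_null] cancels it. *)
apply: (@tate_null_torsion _ v).
have -> : 1 + q = q * (b + 1) by rewrite mulrDr mulrV// mulr1.
rewrite -scalerA e; apply: nullZ; apply: nullB; last exact: tate_null_double.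
apply: nullB => //; apply: nullZ; apply: null_trans (pi_simple _ Ss) _.
by rewrite -CB; exact: CNull.
Qed.

Lemma pi_bar m : null (pi (barM m) - barHv (pi m)).
Proof.
elim/(basis_ind (inv_basis hM)): m => [|x y hx hy|w c Iw].
- by rewrite raddf0 raddf0 rmorph0 subrr; exact: tate_null0.
- by rewrite raddfD raddfD raddfD rmorphD opprD addrACA; exact: nullD.
have [c' [cE cE']] := bar_scalars c.
rewrite (inv_barZ hbarM) cE !piZ cE' pi_a// -scalerBr.
by apply/nullZ/pi_bar_a.
Qed.

End InvolutionModule.

(** * Comparison of the two families of polynomials *)

Theorem theorem9p10
  (* the Coxeter group and its automorphism *)
  (W : groupType) (S : set W) (hW : coxeter_system S)
  (star : {multiplicative W -> W}) (starK : involutive star)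
  (starS : forall s, S s -> S (star s))
  (* A = Z[u, u^-1], the Hecke algebra H and its bar involution *)
  (A : comUnitRingType) (u : A) (hA : is_laurent_ring u)
  (H : unitAlgType A) (T : W -> H) (hH : is_hecke_algebra S (u ^+ 2) T)
  (barH : {rmorphism H -> H}) (hbarH : is_hecke_bar u T barH)
  (* the H-module M and its bar operator *)
  (M : lmodType H) (a : W -> M) (hM : is_involution_module S star u T a)
  (barM : {additive M -> M}) (hbarM : is_involution_bar barH a barM)
  (* Av = Z[v, v^-1], containing A via u = v^2, and Mv = Av (x)_A M *)
  (Av : comUnitRingType) (v : Av) (hAv : is_laurent_ring v)
  (phi : {rmorphism A -> Av}) (hphi : phi u = v ^+ 2)
  (Mv : lmodType Av) (iota : {additive M -> Mv})
  (hMv : is_scalar_extension phi (fun (c : A) (m : M) => c%:A *: m) iota)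
  (barMv : {additive Mv -> Mv})
  (hbarMv : forall (n : int) (m : M),
     barMv (v ^ n *: iota m) = v ^ (- n) *: iota (barM m))
  (* the polynomials P^sigma *)
  (Psigma : W -> W -> {poly int})
  (hPsigma : is_sigma_family S star v (fun y => iota (a y)) barMv Psigma)
  (* the Hecke algebra over Av with parameter v^2, and the polynomials P *)
  (Hv : unitAlgType Av) (t : W -> Hv) (hHv : is_hecke_algebra S (v ^+ 2) t)
  (barHv : {rmorphism Hv -> Hv}) (hbarHv : is_hecke_bar v t barHv)
  (P : W -> W -> {poly int}) (hP : is_KL_family S v t barHv P) :
  forall x w : W, twisted_involutions star x -> twisted_involutions star w ->
    bruhat S x w ->
    exists Q : {poly int}, Psigma x w - P x w = Q *+ 2.

Proof.
move=> x w Ix Iw xw.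
have [tau tauE] := hecke_twist star hHv.
have [f [fZ fT]] := hecke_coef hHv.
have [pi piE] := involution_to_hecke hM phi t.
have pi_null := pi_bar hW starK starS hA hH hbarH hM hbarM hAv hphi hHv
  hbarHv tauE piE.
have pi_lin := piZ hM piE.
set q := v ^+ 2 in hHv hP *.
pose l := cox_length S; pose tw := twist star.
have tww : tw w = w by exact: Iw.
pose Y : seq W := fset_set [set y | bruhat S y w].
have Yfin := bruhat_finite hW w.
have mY y : (y \in Y) = `[< bruhat S y w >] by rewrite in_fset_set// inE.
have uY : uniq Y by exact: fset_uniq.
pose Y2 := [seq y <- Y | tw y == y].
have ltY y : y \in Y -> y != w -> bruhat_lt S y w.
  by rewrite mY => /asboolP yw /eqP.
have twY y : y \in Y -> tw y \in Y.
  rewrite !mY => /asboolP yw; apply/asboolP; rewrite -tww.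
  exact: (bruhat_twist hW starK starS).
pose ev (p : {poly int}) : Av := (map_poly intr p).[q].
have evB p r : ev (p - r) = ev p - ev r by rewrite /ev rmorphB hornerD hornerN.
pose C := v ^ (- (l w)%:Z) *: \sum_(y <- Y) ev (P y w) *: t y.
have barC : barHv C = C.
  by have := KL_bar hP w; rewrite /= fsbig_finite.
have tauC : tau C = v ^ (- (l w)%:Z) *: \sum_(y <- Y) ev (P (tw y) w) *: t y.
  rewrite /C (tauZ hHv tauE) raddf_sum /=; congr (_ *: _).
  have pY : perm_eq Y (map tw Y).
    apply: uniq_perm => //.
      by rewrite map_inj_uniq//; exact: inv_inj (twistK starK).
    move=> y; apply/idP/mapP => [/twY yY|[z /twY zY ->//]].
    by exists (tw y) => //; rewrite /tw twistK.
  rewrite [RHS](perm_big _ pY) big_map; apply: eq_bigr => y _.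
  by rewrite tauE /tw twistK.
have size_sub (k : nat) (p r : {poly int}) :
    ((size p).-1.*2 < k)%N -> ((size r).-1.*2 < k)%N ->
    ((size (p - r)%R).-1.*2 < k)%N.
  move=> hp hr; have := size_polyD p (- r); rewrite size_polyN.
  by rewrite leq_max => /orP[] h;
    [apply: leq_ltn_trans hp | apply: leq_ltn_trans hr]; rewrite leq_double -!subn1 leq_sub2r.
have degP y : y \in Y -> y != w -> ((size (P y w)).-1.*2 < l w - l y)%N.
  move=> yY yw; have h := ltY y yY yw.
  by have := KL_deg hP h; have := bruhat_lt_length h; rewrite -/l; lia.
(* Both [C] and [tau C] are bar-invariant. Uniqueness applied to their difference gives the symmetry
   of [P] modulo 2, which is all that is needed. *)
have P_twist y : y \in Y -> exists Q, P y w - P (tw y) w = Q *+ 2.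
  move: y; apply: (KL_uniqueness hW hAv hHv hbarHv (n := l w) fZ fT) => //.
    move=> y yY E0.
    (* The degree bound fails to apply only at [y = w], where the difference is zero. *)
    have yw : y != w by apply: contraNneq E0 => ->; rewrite tww subrr.
    have tyw : tw y != w.
      by apply: contraNneq yw => e; rewrite -tww -e /tw twistK.
    have := size_sub _ _ _ (degP _ yY yw).
    have := degP _ (twY _ yY) tyw.
    rewrite (length_twist hW starK starS y : l (tw y) = l y).
    by move=> h /(_ _ h); rewrite ltn_subRL addnC.
  move=> y _; exists 0; rewrite mul0rn.
  rewrite (_ : _ *: _ = C - tau C).
    rewrite rmorphB /= -(tau_bar hW starK starS hAv hHv hbarHv tauE) barC.
    by rewrite subrr raddf0.
  rewrite tauC -scalerBr -sumrB; congr (_ *: _); apply: eq_bigr => z _.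
  by rewrite -scalerBl -evB.
(* The part of [C] outside the twisted involutions, null by the symmetry of [P]. *)
pose Z := v ^ (- (l w)%:Z) *: \sum_(y <- Y | tw y != y) ev (P y w) *: t y.
have Znull : tate_null v tau Z.
  apply: (tate_nullZ hHv tauE).
  apply: (tate_null_noninvolutions starK hHv tauE) => // y yY.
  have [Q QE] := P_twist y yY; exists (- ev Q).
  have -> : P (tw y) w = P y w - Q *+ 2 by rewrite -QE opprB addrC subrK.
  by rewrite evB /ev rmorphMn hornerMn mulNrn.
pose m := \sum_(y <- Y2) ((map_poly intr (Psigma y w)).[u])%:A *: a y.
have mI y : y \in Y2 -> twisted_involutions star y.
  by rewrite mem_filter => /andP[/eqP].
have mY2 y : y \in Y2 -> y \in Y by rewrite mem_filter => /andP[].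
have phi_ev p : phi (map_poly intr p).[u] = ev p.
  rewrite /ev -horner_map /= hphi -map_poly_comp /=; congr (_.[_]).
  by apply: eq_map_poly => n /=; rewrite rmorph_int.
have pim : pi m = \sum_(y <- Y2) ev (Psigma y w) *: t y.
  rewrite raddf_sum; apply: eq_big_seq => y /mI Iy.
  by rewrite piE// phi_ev.
pose Cs := v ^ (- (l w)%:Z) *: pi m.
have Cs_null : tate_null v tau (barHv Cs - Cs).
  have vU := laurent_unit hAv.
  have iotaE : iota m = \sum_(y \in [set y | twisted_involutions star y /\
      bruhat S y w]) ev (Psigma y w) *: iota (a y).
    rewrite (@fsbigE _ _ _ _ _ Y2); first last.
    - move=> y [Iy yw]; rewrite mem_filter mY => /negP[].
      by apply/andP; split; [apply/eqP | apply/asboolP].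
    - by move=> y /= yY2; split; [exact: mI | apply/asboolP; rewrite -mY mY2].
    - by rewrite filter_uniq.
    rewrite raddf_sum [RHS]big_mkcond; apply: eq_big_seq => y yY2.
    rewrite ifT; first by case: hMv => -> _; rewrite phi_ev.
    by apply: mem_set; split; [exact: mI | apply/asboolP; rewrite -mY mY2].
  have := sigma_bar hPsigma Iw; rewrite /= -/q -iotaE hbarMv opprK.
  (* By the universal property [pi] factors through [iota], which carries the bar-invariance of the
     element in [Mv] over to [Hv]. *)
  case: hMv => _ /(_ Hv pi pi_lin)[g [[glin giota] _]].
  have g0 : g 0 = 0.
    have := glin 1 0 0; rewrite !scale1r addr0 => /eqP.
    by rewrite -[X in X == _]addr0 (inj_eq (addrI _)) => /eqP.
  have gZ c x' : g (c *: x') = c *: g x' by have := glin c x' 0; rewrite g0 !addr0.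
  move=> /(congr1 g); rewrite !gZ !giota => piM.
  rewrite /Cs (bar_exp hHv hbarHv) opprK -piM -scalerBr.
  apply: (tate_nullZ hHv tauE); apply: (tate_null_sym hHv tauE); exact: pi_null.
have key y : y \in Y2 -> exists Q, Psigma y w - P y w = Q *+ 2.
  move: y; apply: (KL_uniqueness hW hAv hHv hbarHv (n := l w) fZ fT).
  - by rewrite filter_uniq.
  - move=> y yY2 E0; have yY := mY2 y yY2.
    have yw : y != w.
      apply: contraNneq E0 => ->.
      by rewrite (sigma_diag hPsigma Iw) (KL_diag hP) subrr.
    have h := ltY y yY yw; have := bruhat_lt_length h.
    have := sigma_deg hPsigma (mI y yY2) Iw h; rewrite -/l => h1 h2.
    rewrite addnC -ltn_subRL; apply: size_sub; last exact: degP.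
    by apply: leq_ltn_trans h1 _; rewrite subn1 prednK// subn_gt0.
  (* [C - Z] keeps the terms of [C] at twisted involutions. Since [C] is bar-invariant and [Z] is
     null, the defect of bar-invariance is null, so its coefficients at twisted involutions are
     even. *)
  move=> y yY2; rewrite (_ : _ *: _ = Cs - (C - Z)); last first.
    have -> : C = v ^ (- (l w)%:Z) *: (\sum_(y <- Y2) ev (P y w) *: t y) + Z.
      by rewrite /C (bigID (fun y => tw y == y)) /= scalerDr big_filter.
    rewrite addrK /Cs pim -scalerBr -sumrB; congr (_ *: _).
    by apply: eq_bigr => z _; rewrite -scalerBl -evB.
  apply: (tate_null_coef starK hAv hHv tauE fZ fT (mI y yY2)).
  have -> : barHv (Cs - (C - Z)) - (Cs - (C - Z)) =
      (barHv Cs - Cs) + (barHv Z - Z).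
    by rewrite !rmorphB /= barC !opprB !addrA subrK addrAC [_ + _ - Cs]addrAC.
  apply: (tate_nullD hHv tauE) => //; apply: (tate_nullB hHv tauE) => //.
  exact: (tate_null_bar hW starK starS hAv hHv hbarHv tauE).
apply: key; rewrite mem_filter mY; apply/andP; split; first exact/eqP.
exact/asboolP.
Qed.
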